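(* Let $d\ge1$ and let $\Omega$ be the set of functions $\omega:\mathbb Z^d\times\mathbb Z^d\to[0,\infty)$ such that $\omega(x,y)=\omega(y,x)$ for all $x,y$, and $\omega(x,y)>0$ if and only if $x\sim y$. Let $\mathbb Q$ and $\mathbb Q'$ be two translation invariant probabilities on $\Omega$ such that $\mathbb Q'\ge\mathbb Q$, in the sense that $\mathbb Q'(f)\ge\mathbb Q(f)$ for every bounded measurable increasing function $f:\Omega\to\mathbb R$. Assume that for $(\mathbb Q+\mathbb Q')$-almost all $\omega$ the Markov chain $X_t$ is conservative under $\mathbb P^\omega_0$. Then, for all times $t\ge 0$, $$\int\mathbb P^\omega_0[X_t=0]\,d\mathbb Q'(\omega)\ \le\ \int\mathbb P^\omega_0[X_t=0]\,d\mathbb Q(\omega).$$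
   Context: $x\sim y$ means that $x,y\in\mathbb Z^d$ are nearest neighbors. A function $f:\Omega\to\mathbb R$ is increasing if $f(\omega')\ge f(\omega)$ whenever $\omega'(x,y)\ge\omega(x,y)$ for all $x,y$. For $\omega\in\Omega$, $\mathbb P^\omega_x$ is the law of the continuous time Markov chain on $\mathbb Z^d$ with $X_0=x$ and generator $$\mathcal G^\omega f(x)=\sum_{y\sim x}\omega(x,y)[f(y)-f(x)],$$ i.e. when at $z$ the process waits an exponential time of parameter $\sum_{y\sim z}\omega(z,y)$ and then jumps to a neighbor $z_1$ with probability $\omega(z,z_1)/\sum_{y\sim z}\omega(z,y)$, with independent waiting times (the minimal process, killed at explosion). Conservative means that there is no explosion: almost surely the process performs only finitely many jumps in every finite time interval. Translation invariance of $\mathbb Q$ means invariance under the shifts $\omega(\cdot,\cdot)\mapsto\omega(\cdot+z,\cdot+z)$, $z\in\mathbb Z^d$. *)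

(* Defs.v *)
From HB Require Import structures.
From mathcomp Require Export all_boot all_order all_algebra.
From mathcomp Require Export all_classical all_reals all_analysis.

Set Implicit Arguments.
Unset Strict Implicit.
Unset Printing Implicit Defensive.

Import Order.TTheory GRing.Theory Num.Theory.

Local Open Scope classical_set_scope.
Local Open Scope ring_scope.

Notation lattice d := 'rV[int]_d.

Definition nbr (d : nat) (x y : lattice d) : bool :=
  \sum_(i < d) `|x ord0 i - y ord0 i| == 1.

Record environment (R : realType) (d : nat) := Environment {
  conductance :> lattice d -> lattice d -> R;
  conductance_ge0 : forall x y, 0 <= conductance x y;
  conductance_sym : forall x y, conductance x y = conductance y x;
  conductance_gt0 : forall x y, 0 < conductance x y <-> nbr x y
}.

HB.instance Definition _ (R : realType) (d : nat) :=
  gen_eqMixin (environment R d).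
HB.instance Definition _ (R : realType) (d : nat) :=
  gen_choiceMixin (environment R d).

(* Measurable types must be pointed: the point is the environment equal to 1
   on every edge. *)
Program Definition unit_environment (R : realType) (d : nat) :
  environment R d := @Environment R d (fun x y => (nbr x y)%:R) _ _ _.
Next Obligation. by move=> R d x y; rewrite ler0n. Qed.
Next Obligation.
by move=> R d x y; rewrite /nbr; under eq_bigr do rewrite distrC.
Qed.
Next Obligation. by move=> R d x y; rewrite ltr0n lt0b. Qed.

HB.instance Definition _ (R : realType) (d : nat) :=
  isPointed.Build (environment R d) (unit_environment R d).

(* The product sigma-algebra, generated by the coordinates
   w |-> w(x, y). *)
Definition cylinders (R : realType) (d : nat) : set_system (environment R d) :=
  [set A | exists x y : lattice d, exists2 B : set R,
     measurable B & A = [set w : environment R d | B (w x y)]].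

Definition Omega (R : realType) (d : nat) :=
  g_sigma_algebraType (@cylinders R d).

Program Definition shift (R : realType) (d : nat) (z : lattice d)
    (w : Omega R d) : Omega R d :=
  @Environment R d (fun x y => (w : environment R d) (x + z) (y + z)) _ _ _.
Next Obligation. by move=> R d z w x y; apply: conductance_ge0. Qed.
Next Obligation. by move=> R d z w x y; apply: conductance_sym. Qed.
Next Obligation.
move=> R d z w x y; rewrite (conductance_gt0 w (x + z) (y + z)).
suff -> : nbr (x + z) (y + z) = nbr x y by [].
by rewrite /nbr; under eq_bigr do rewrite !mxE opprD addrACA subrr addr0.
Qed.

Definition translation_invariant (R : realType) (d : nat)
    (Q : set (Omega R d) -> \bar R) :=
  forall (z : lattice d) (A : set (Omega R d)),
    measurable A -> Q (shift z @^-1` A) = Q A.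

Definition increasing (R : realType) (d : nat) (f : Omega R d -> R) :=
  forall w w' : Omega R d,
    (forall x y : lattice d,
       (w : environment R d) x y <= (w' : environment R d) x y) ->
    f w <= f w'.

Definition stochastically_dominates (R : realType) (d : nat)
    (Q' Q : probability (Omega R d) R) :=
  forall f : Omega R d -> R,
    measurable_fun setT f -> (exists M : R, forall w, `|f w| <= M) ->
    increasing f ->
    (\int[Q]_w (f w)%:E <= \int[Q']_w (f w)%:E)%E.

Section Chain.
Context (R : realType) (d : nat).

(* A finite sum: x has 2d neighbours. *)
Definition exit_rate (w : environment R d) (x : lattice d) : R :=
  \sum_(y \in [set y | nbr x y]) w x y.

Definition jump_prob (w : environment R d) (x y : lattice d) : R :=
  w x y / exit_rate w x.

(* A realization, on some probability space, of the jump chain (Y_n) and of the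
   holding times (S_n) of the minimal chain with rates w started at x.  The
   field chain_law gives the joint law of (Y_0, S_0), ..., (Y_n, S_n): each S_i
   is exponential of rate exit_rate w Y_i, the next site is drawn from
   jump_prob w Y_i, and given the sites the holding times are independent of
   one another. *)
Record chain (w : environment R d) (x : lattice d) := Chain {
  chain_display : measure_display;
  chain_space : measurableType chain_display;
  chain_prob : probability chain_space R;
  site : nat -> chain_space -> lattice d;
  holding : nat -> chain_space -> R;
  measurable_site : forall n (y : lattice d),
    measurable (site n @^-1` [set y]);
  measurable_holding : forall n, measurable_fun setT (holding n);
  chain_law : forall n (y : nat -> lattice d) (B : nat -> set R),
    (forall i, measurable (B i)) ->
    chain_prob [set s | forall i, (i <= n)%N ->
                          site i s = y i /\ B i (holding i s)] =
    ((y 0%N == x)%:R%:E *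
     (\prod_(i < n) jump_prob w (y i) (y i.+1))%:E *
     \prod_(i < n.+1) exponential_prob (exit_rate w (y i)) (B i))%E
}.

Definition jump_time (w : environment R d) (x : lattice d) (c : chain w x)
    (n : nat) (s : chain_space c) : R :=
  \sum_(i < n) holding i s.

(* X_t is the site Y_n with n least such that t < S_0 + ... + S_n; it is None,
   the cemetery, from the explosion time on. *)
Definition position (w : environment R d) (x : lattice d) (c : chain w x)
    (t : R) (s : chain_space c) : option (lattice d) :=
  if pselect (exists n, t < jump_time n.+1 s) is left e
  then Some (site (ex_minn e) s) else None.

Definition conservative (w : environment R d) (x : lattice d)
    (c : chain w x) : Prop :=
  {ae chain_prob c, forall s, forall t : R,
     finite_set [set n | (0 < n)%N /\ jump_time n s <= t]}.

(* P^w_x [X_t = y] *)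
Definition transition_prob (w : environment R d) (x : lattice d)
    (c : chain w x) (t : R) (y : lattice d) : \bar R :=
  chain_prob c [set s | position t s = Some y].

End Chain.

(* Main.v *)
From HB Require Import structures.
Require Import Defs.
From mathcomp Require Import all_boot all_order all_algebra.
From mathcomp Require Import finmap.
From mathcomp Require Import all_classical all_reals all_analysis.
From mathcomp Require Import measurable_realfun ring lra zify.
From mathcomp Require polyrcf.

Set Implicit Arguments.
Unset Strict Implicit.
Unset Printing Implicit Defensive.

Import Order.TTheory GRing.Theory Num.Theory.
Import numFieldNormedType.Exports.

Local Open Scope classical_set_scope.
Local Open Scope ring_scope.

(* Let G be the generator of the chain killed on leaving a finite box B.  The
   sum over x in B of P_x[X_t = x, no exit from B before t] is the trace of
   exp(tG), and -G is a quadratic form increasing in the conductances; hence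
   this trace is a bounded decreasing function of w, and its expectation under
   Q' is at most that under Q.  By translation invariance each expectation is
   a sum over x in B of integrals of
   P_0[X_t = 0, no exit from B - x before t].  Such an integral is at most that
   of P_0[X_t = 0], and it is at least that of
   P_0[X_t = 0, no exit from [-M, M]^d before t] unless x is within M of the
   boundary of B.  Dividing by |B|, letting B grow and then M tend to infinity
   concludes, because the minimal chain is the increasing limit of the killed
   ones.

   The trace is handled through uniformization: for lam large, exp(tG) is
   e^(-lam t) sum_m t^m/m! (lam + G)^m with lam + G positive semidefinite, and
   the trace of each power is monotone.  That the killed chain has this
   semigroup is checked path by path: given the sites, the probability of n
   jumps before t is an n-fold convolution of exponential laws, which is
   computed as a power series in t. *)

(** * Exponential holding times *)

Section density.
Context d (T : measurableType d) (R : realType).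
Import HBNNSimple.
Local Open Scope ereal_scope.

(** Both sides are limits, by monotone convergence, of the integrals of the simple approximations
    [f_]; on the indicator of a level set the identity is the hypothesis on [nu]. *)
Lemma ge0_integral_density (mu nu : {measure set T -> \bar R}) (p : T -> R)
    (f : T -> \bar R) :
  measurable_fun setT p -> (forall x, 0 <= p x)%R ->
  (forall A, measurable A -> nu A = \int[mu]_(x in A) (p x)%:E) ->
  measurable_fun setT f -> (forall x, 0 <= f x) ->
  \int[nu]_x f x = \int[mu]_x (f x * (p x)%:E).
Proof.
move=> mp p0 nuE mf f0.
have mpE : measurable_fun setT (EFin \o p) by exact/measurable_EFinP.
pose f_ := nnsfun_approx measurableT mf.
have fE x : f x = limn (fun n => (f_ n x)%:E).
  by apply/esym/cvg_lim => //; exact: cvg_nnsfun_approx.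
have fnd x : {homo (fun n => (f_ n x)%:E) : a b / (a <= b)%N >-> a <= b}.
  by move=> a b ab; rewrite lee_fin; exact/lefP/nd_nnsfun_approx.
have fcvg x : cvgn (fun n => (f_ n x)%:E).
  exact: ereal_nondecreasing_is_cvgn.
transitivity (limn (fun n => \int[nu]_x (f_ n x)%:E)).
  under eq_integral do rewrite fE.
  rewrite monotone_convergence//; first last.
  - by move=> n x _; rewrite lee_fin.
  - by move=> n; exact/measurable_EFinP/measurable_funTS.
transitivity (
          limn (fun n => \int[mu]_x ((f_ n x)%:E * (p x)%:E))); last first.
  under [RHS]eq_integral.
    move=> x _; rewrite fE muleC -limeMl//.
    under eq_fun do rewrite muleC.
    over.
  rewrite monotone_convergence//; first last.
  - by move=> x _ a b ab; rewrite muleC [leRHS]muleC lee_wpmul2l ?lee_fin//; exact: fnd.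
  - by move=> n x _; rewrite mule_ge0// lee_fin.
  - by move=> n; apply: emeasurable_funM => //; exact/measurable_EFinP/measurable_funTS.
congr (limn _); apply/funext => n.
have fnE x : (f_ n x)%:E = \sum_(y \in range (f_ n)) (y * \1_(f_ n @^-1` [set y]) x)%:E.
  by rewrite fimfunE -fsumEFin.
under eq_integral do rewrite fnE.
under [RHS]eq_integral.
  move=> x _; rewrite fnE muleC ge0_mule_fsumr; last first.
    by move=> y; rewrite EFinM nnfun_muleindic_ge0.
  over.
rewrite !ge0_integral_fsum//=; first last.
- by move=> y x _; rewrite EFinM nnfun_muleindic_ge0.
- by move=> y; exact/measurable_EFinP/measurableT_comp.
- by move=> y x _; apply: mule_ge0; [rewrite lee_fin|rewrite EFinM nnfun_muleindic_ge0].
- by move=> y; apply: emeasurable_funM => //; exact/measurable_EFinP/measurableT_comp.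
apply: eq_fsbigr => y; rewrite inE/= => -[x0 _ yE].
have y0 : (0 <= y)%R by rewrite -yE.
under eq_integral do rewrite EFinM.
rewrite ge0_integralZl//; last exact/measurable_EFinP.
under [RHS]eq_integral do rewrite EFinM muleCA.
rewrite [RHS]ge0_integralZl//; first last.
- by move=> x _; rewrite mule_ge0// lee_fin.
- by apply: emeasurable_funM => //; exact/measurable_EFinP.
congr (_ * _).
rewrite integral_indic// setIT nuE//.
rewrite integral_mkcond; apply: eq_integral => x _.
by rewrite patchE indicE; case: ifPn => _; rewrite ?mule1 ?mule0.
Qed.
End density.

(** * Integrals of an exponential against a monomial *)

Section exp_integral.
Context (R : realType).
Notation mu := (@lebesgue_measure R).

Lemma is_derive_affineX (a r b : R) (n : nat) :
  is_derive b 1 (fun b => (a * (r - b)) ^+ n)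
    (n%:R * (a * (r - b)) ^+ n.-1 * - a).
Proof.
have D : is_derive b 1 (fun b => a * (r - b)) (- a).
  by apply: is_derive_eq; rewrite /GRing.scale/=; ring.
have := is_deriveX n D.
by rewrite exprfctE.
Qed.

(** The derivative of the Taylor sum in [b] is [- a] times the sum without its last term, so the
    product rule leaves only the term of degree [m]. *)
Lemma is_derive_expR_taylor (a r b : R) (m : nat) :
  is_derive b 1 (fun b => expR (a * b) * \sum_(j < m.+1) (a * (r - b)) ^+ j / j`!%:R)
    (a * (expR (a * b) * ((a * (r - b)) ^+ m / m`!%:R))).
Proof.
have dexp : is_derive b 1 (fun b => expR (a * b)) (a * expR (a * b)).
  by apply: is_derive_eq; rewrite /GRing.scale/= mulr1 mulrC.
elim: m => [|m IH].
  under eq_fun do rewrite big_ord_recr big_ord0/= add0r expr0 fact0 divr1 mulr1.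
  by rewrite expr0 fact0 divr1 mulr1.
under eq_fun do rewrite big_ord_recr/= mulrDr.
have dpow : is_derive b 1 (fun b => (a * (r - b)) ^+ m.+1 / m.+1`!%:R)
    (- a * ((a * (r - b)) ^+ m / m`!%:R)).
  have D := is_derive_affineX a r b m.+1.
  apply: is_derive_eq; rewrite /GRing.scale/= factS natrM.
  have m0 : m.+1%:R != 0 :> R by rewrite pnatr_eq0.
  have f0 : m`!%:R != 0 :> R by rewrite pnatr_eq0 -lt0n fact_gt0.
  field.
  by rewrite f0 nat1r m0.
apply: is_derive_eq.
rewrite /GRing.scale/=.
ring.
Qed.

(** Both sides equal [a ^- m.+1] times what remains of the exponential series at [a * r] after the
    terms of degree at most [m]: the sum on the right is that tail, and the integral comes from the
    antiderivative [F]. *)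
Lemma integral_expR_monomial (a r : R) (m : nat) : 0 < a -> 0 <= r ->
  (\int[mu]_(b in `[0%R, r]) (expR (a * b) * ((r - b) ^+ m / m`!%:R))%:E =
   \sum_(k <oo) (a ^+ k * (r ^+ (k + m.+1) / (k + m.+1)`!%:R))%:E)%E.
Proof.
move=> a0 r0.
have a0' : a != 0 by rewrite gt_eqF.
have taylor : (\sum_(k <oo) (a ^+ k * (r ^+ (k + m.+1) / (k + m.+1)`!%:R))%:E =
  (a ^- m.+1 * (expR (a * r) - \sum_(j < m.+1) (a * r) ^+ j / j`!%:R))%:E)%E.
  apply/cvg_lim => //.
  have -> : (fun n => \sum_(0 <= k < n) (a ^+ k * (r ^+ (k + m.+1) / (k + m.+1)`!%:R))%:E)%E =
     (fun n => (a ^- m.+1 * (series (exp_coeff (a * r)) (n + m.+1)%N -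
       \sum_(j < m.+1) (a * r) ^+ j / j`!%:R))%:E).
    apply/funext => n; rewrite sumEFin; congr (_%:E).
    have tail (f : nat -> R) :
        \sum_(m.+1 <= k < m.+1 + n) f k = \sum_(0 <= k < n) f (k + m.+1)%N.
      by rewrite -{1}[m.+1]add0n big_addn addKn.
    rewrite /series/= addnC [in RHS](big_cat_nat (n := m.+1))//= ?leq_addr//.
    rewrite tail [X in _ * (X + _ - _)]big_mkord addrAC subrr add0r mulr_sumr.
    apply: eq_bigr => k _; rewrite exp_coeffE/= exprMn [a ^+ (k + _)]exprD.
    by field; rewrite ?a0' ?expf_neq0//= ?pnatr_eq0 -?lt0n ?fact_gt0 ?a0'.
  apply/fine_cvgP => /=; split; first exact: nearW.
  apply: cvgMr; apply: cvgB; last exact: cvg_cst.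
  have := @is_cvg_series_exp_coeff R (a * r).
  by rewrite -/(expR _) -(cvg_shiftn m.+1).
rewrite taylor.
pose F (b : R) : R := a ^- m.+1 * (expR (a * b) * \sum_(j < m.+1) (a * (r - b)) ^+ j / j`!%:R).
have FE (b : R) : is_derive b 1 F (expR (a * b) * ((r - b) ^+ m / m`!%:R)).
  have := is_derive_expR_taylor a r b m => h.
  apply: is_derive_eq.
  rewrite /GRing.scale/= exprMn exprS.
  by field; rewrite ?a0' ?expf_neq0//= ?pnatr_eq0 -?lt0n ?fact_gt0 ?a0'.
(* For [r = 0] the interval is a point and both sides vanish; the fundamental theorem of calculus is
   applied for [0 < r]. *)
case: (ltgtP 0 r) r0 => // [r0 _|<- _]; last first.
  rewrite set_itv1 integral_set1 mulr0 expR0 big_ord_recl/= expr0 fact0 divr1.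
  rewrite big1 ?addr0 ?subrr ?mulr0//.
  by move=> i _; rewrite expr0n/= mul0r.
have cf : continuous (fun b : R => expR (a * b) * ((r - b) ^+ m / m`!%:R)).
  move=> b; apply: differentiable_continuous; apply/derivable1_diffP.
  have D := is_derive_affineX 1 r b m.
  under eq_fun do rewrite -[r - _]mul1r.
  by apply: ex_derive.
have cF : continuous F.
  by move=> b; apply: differentiable_continuous; apply/derivable1_diffP; have [] := FE b.
rewrite (@continuous_FTC2 _ _ F)//.
- rewrite -EFinB; congr (_%:E).
  rewrite /F mulr0 expR0 mul1r big_ord_recl/= expr0 fact0 divr1 big1; last first.
    by move=> i _; rewrite subrr mulr0 expr0n/= mul0r.
  by rewrite addr0 mulr1 -mulrBr; under [in LHS]eq_bigr do rewrite subr0.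
- exact: continuous_subspaceT.
- split.
  + by move=> z _; have [] := FE z.
  + by apply/cvg_at_right_filter; exact: cF.
  + by apply/cvg_at_left_filter; exact: cF.
- by move=> z _; rewrite derive1E; exact: derive_val.
Qed.
End exp_integral.

Lemma measurable_preimageT d d' (T : measurableType d) (T' : measurableType d')
    (f : T -> T') : measurable_fun setT f ->
  forall A, measurable A -> measurable (f @^-1` A).
Proof. by move=> mf A mA; rewrite -[X in measurable X]setTI; exact: mf. Qed.

Lemma measurable_ler d (T : measurableType d) (R : realType) (f g : T -> R) :
  measurable_fun setT f -> measurable_fun setT g ->
  measurable [set x | f x <= g x].
Proof.
by move=> mf mg; rewrite -[X in measurable X]setTI; exact: measurable_fun_le.
Qed.

Lemma measurable_ltr d (T : measurableType d) (R : realType) (f g : T -> R) :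
  measurable_fun setT f -> measurable_fun setT g ->
  measurable [set x | f x < g x].
Proof.
move=> mf mg; rewrite (_ : [set x | _] = ~` [set x | g x <= f x]).
  exact/measurableC/measurable_ler.
by apply/seteqP; split => x /=; rewrite ltNge => /negP.
Qed.

(** * Independence and Fubini's theorem *)

Section independence.
Context d (T : measurableType d) (R : realType).
Notation RR := (measurableTypeR R).
Local Open Scope ereal_scope.

(** The law of [(U, V)] under [m'] agrees on rectangles with [C] times the product of the law of [U]
    under [m] and of [mu], hence everywhere, and Tonelli applies. Separate [m'] and [C] allow [m']
    to be [m] restricted to an event that scales masses by [C]. *)
Lemma ge0_integral_indep (m m' : {measure set T -> \bar R}) (C : {nonneg R})
    (U V : T -> RR) (mu : probability RR R) (F : RR * RR -> \bar R) :
  measurable_fun setT U -> measurable_fun setT V -> m setT < +oo ->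
  (forall A B, measurable A -> measurable B ->
    m' (U @^-1` A `&` V @^-1` B) = C%:num%:E * m (U @^-1` A) * mu B) ->
  measurable_fun setT F -> (forall z, 0 <= F z) ->
  \int[m']_s F (U s, V s) = C%:num%:E * \int[m]_s \int[mu]_b F (U s, b).
Proof.
move=> mU mV mfin indep mF F0.
have mUV : measurable_fun setT (fun s => (U s, V s)).
  by apply/measurable_fun_pairP; split.
pose UV : {mfun T >-> (RR * RR)%type} :=
  HB.pack (fun s => (U s, V s)) (isMeasurableFun.Build _ _ _ _ _ mUV).
pose pU : {measure set RR -> \bar R} :=
  measure_function_pushforward__canonical__measure_function_Measure m mU.
have mfin1 : fin_num_fun (mscale C pU).
  move=> A mA; rewrite /mscale fin_numM// ge0_fin_numE ?measure_ge0//.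
  apply: le_lt_trans mfin; apply: (le_measure m); rewrite ?inE//.
  exact: measurable_preimageT mU _ mA.
pose m1 : {finite_measure set RR -> \bar R} :=
  HB.pack (mscale C pU) (Measure_isFinite.Build _ _ _ _ mfin1).
have E A : measurable A -> (m1 \x mu) A = pushforward m' UV A.
  apply: product_measure_unique => A' B mA mB.
  rewrite /= /pushforward /mscale -indep//.
transitivity (\int[pushforward m' UV]_z F z).
  by rewrite [RHS]ge0_integral_pushforward.
transitivity (\int[m1 \x mu]_z F z).
  by apply: eq_measure_integral => A mA _; exact/esym/E.
rewrite fubini_tonelli1//.
have mG : measurable_fun setT (fun x : RR => \int[mu]_b F (x, b)).
  exact: measurable_fun_fubini_tonelli_F.
rewrite (@ge0_integral_mscale _ _ _ pU _ measurableT C)//; last first.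
  by move=> x _; exact: integral_ge0.
by rewrite ge0_integral_pushforward// => x _; exact: integral_ge0.
Qed.
End independence.

Definition exp_law (R : realType) (q : R) (q0 : 0 < q) :
  probability (measurableTypeR R) R.
Proof.
by refine (exponential_prob q : probability (measurableTypeR R) R); exact: q0.
Defined.

(** * Convolutions with exponential laws as power series *)

Section exponential_law.
Context (R : realType).
Notation RR := (measurableTypeR R).
Notation mu := (@lebesgue_measure R).
Implicit Types (q lam r : R) (c : nat -> R).

Lemma exp_prob_tail q r : 0 < q -> 0 <= r ->
  exponential_prob q `]r, +oo[ = (expR (- q * r))%:E.
Proof.
move=> q0 r0.
have cE (x : R) : is_derive x 1 (fun x => - expR (- q * x)) (q * expR (- q * x)).
  by apply: is_derive_eq; rewrite /GRing.scale/=; ring.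
have cont : continuous (fun x : R => - expR (- q * x)).
  by move=> b; apply: differentiable_continuous; apply/derivable1_diffP; have [] := cE b.
have -> : exponential_prob q `]r, +oo[ = exponential_prob q `[r, +oo[.
  apply: integral_itv_obnd_cbnd.
  by apply/measurable_EFinP/measurable_funTS; exact: measurable_exponential_pdf.
rewrite /exponential_prob (@ge0_continuous_FTC2y _ _ (fun x => - expR (- q * x)) _ 0).
- by rewrite sub0e -EFinN opprK.
- by move=> x _; apply: exponential_pdf_ge0; exact: ltW.
- apply: (@continuous_subspaceW R^o _ _ [set` `[0, +oo[%R]); last first.
    exact: within_continuous_exponential_pdf.
  by apply: subset_itvr; rewrite bnd_simp.
- rewrite -oppr0; apply: cvgN.
  rewrite (_ : (fun x => expR (- q * x)) =
               (fun z => expR (- z)) \o (fun z => q * z)); last first.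
    by apply: eq_fun => x; rewrite mulNr.
  apply: (@cvg_comp _ _ _ _ _ _ (pinfty_nbhs R)); last exact: cvgr_expR.
  exact: gt0_cvgMry.
- by move=> x _; have [] := cE x.
- by apply/cvg_at_right_filter; exact: cont.
- move=> z; rewrite in_itv/= andbT => rz; rewrite derive1E.
  rewrite exponential_pdfE; last exact: ltW (le_lt_trans r0 rz).
  by have [_ ->] := cE z.
Qed.

(** Uniformization: with [c m] an entry of (lam + G)^m this is the same entry of exp(rG). The value
    0 for [r < 0] lets convolutions run over the whole line. *)
Definition exp_series lam c r : \bar R :=
  (if (0 <= r)%R then \sum_(m <oo) (expR (- lam * r) * (r ^+ m / m`!%:R) * c m)%:E
   else 0)%E.

Lemma exp_series_ge0 lam c r : (forall m, 0 <= c m) ->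
  (0 <= exp_series lam c r)%E.
Proof.
move=> c0; rewrite /exp_series; case: ifP => // r0.
apply: nneseries_ge0 => m _ _; rewrite lee_fin.
by rewrite !mulr_ge0// ?expR_ge0// ?invr_ge0// exprn_ge0.
Qed.

Lemma measurable_exp_series lam c : (forall m, 0 <= c m) ->
  measurable_fun setT (exp_series lam c : RR -> \bar R).
Proof.
move=> c0.
have -> : exp_series lam c = (fun r : R => \sum_(m <oo | true)
   ((fun r => (expR (- lam * r) * (r ^+ m / m`!%:R) * c m)%:E) \_ `[0%R, +oo[) r)%E.
  apply/funext => r; rewrite /exp_series; case: ifPn => r0.
    by apply: eq_eseriesr => m _; rewrite patchE mem_set//= in_itv/= r0.
  rewrite eseries0// => m _ _; rewrite patchE memNset//= in_itv/= andbT.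
  exact/negP.
apply: ge0_emeasurable_sum => [m r _ _|m _].
  apply: erestrict_ge0 => {}r; rewrite /= in_itv/= andbT => r0; rewrite lee_fin.
  by rewrite !mulr_ge0// ?expR_ge0// ?invr_ge0// exprn_ge0.
apply/(measurable_restrictT _ _).1 => //.
apply/measurable_EFinP/measurable_funTS.
apply: measurable_funM => //; apply: measurable_funM.
  by apply: measurableT_comp => //; exact: measurable_funM.
by apply: measurable_funM => //; exact: exprn_measurable.
Qed.

(** With l = k + m + 1 both sides run over the pairs m < l, and nonnegative terms may be summed in
    any order. *)
Lemma nneseries_triangle (f : nat -> nat -> \bar R) :
  (forall m l, 0 <= f m l)%E ->
  (\sum_(m <oo) \sum_(k <oo) f m (k + m.+1)%N = \sum_(l <oo) \sum_(m < l) f m l)%E.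
Proof.
move=> f0.
transitivity (\sum_(m <oo) \sum_(l <oo) (if (m < l)%N then f m l else 0))%E.
  apply: eq_eseriesr => m _.
  rewrite [RHS](nneseries_split 0 m.+1); last by move=> k _; case: ifP.
  rewrite add0n big_nat big1 ?add0e => [|i /andP[_ im]]; last by rewrite ltnNge -ltnS im.
  rewrite -[RHS](@nneseries_addn _ (fun l => if (m < l)%N then f m l else 0)%E m.+1).
    by apply: eq_eseriesr => k _; rewrite ifT// addnS ltnS leq_addl.
  by move=> i; case: ifP.
rewrite nneseries_interchange; last by move=> i j; case: ifP.
apply: eq_eseriesr => l _.
rewrite [LHS](nneseries_split 0 l); last by move=> k _; case: ifP.
rewrite add0n eseries0 ?adde0; last by move=> i li _; rewrite ltnNge li.
by rewrite big_mkord; apply: eq_bigr => i _; rewrite ltn_ord.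
Qed.

(** The coefficient of z^m in q z C(z) / (1 - (lam - q) z), where C is the generating series of [c];
    for [m = 0] the sum is empty. *)
Definition exp_conv_coef lam q c (m : nat) : R :=
  q * \sum_(j < m) (lam - q) ^+ (m.-1 - j) * c j.

(** The product of e^(-lam (r - b)) and q e^(-q b) is q e^(-lam r) e^((lam - q) b), so
    [integral_expR_monomial] integrates each term. As [q < lam], all terms are nonnegative and can
    be regrouped by their degree in [r]. *)
Lemma integral_exp_law_series lam q c (q0 : 0 < q) r : q < lam ->
  (forall m, 0 <= c m) ->
  (\int[exp_law q0]_b exp_series lam c (r - b) =
   exp_series lam (exp_conv_coef lam q c) r)%E.
Proof.
move=> qlam c0.
have mS : measurable_fun setT (fun b : RR => exp_series lam c (r - b)).
  have mB : measurable_fun setT ((fun b : R => r - b) : RR -> RR).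
    exact: measurable_funB.
  have mS := @measurable_exp_series lam c c0.
  exact: (measurableT_comp mS mB).
rewrite (@ge0_integral_density _ _ _ mu (exp_law q0) (exponential_pdf q))//; last 3 first.
- exact: measurable_exponential_pdf.
- by move=> x; apply: exponential_pdf_ge0; exact: ltW.
- by move=> b; exact: exp_series_ge0.
rewrite [RHS]/exp_series; case: ifPn => r0; last first.
  rewrite integral0_eq// => b _; have [b0|b0] := ltP b 0.
    by rewrite lt0_exponential_pdf// mule0.
  rewrite /exp_series ifF ?mul0e//; apply/negbTE; move: r0; rewrite -!ltNge => r0.
  by rewrite subr_lt0 (lt_le_trans r0).
pose h m b := ((expR (- lam * r) * q * c m) *
  (expR ((lam - q) * b) * ((r - b) ^+ m / m`!%:R)))%:E.
transitivity (\int[mu]_(b in `[0%R, r]) \sum_(m <oo) h m b)%E.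
  rewrite [RHS]integral_mkcond; apply: eq_integral => b _; rewrite patchE.
  case: ifPn => [/set_mem/=|]; rewrite ?in_itv/=.
    move=> /andP[b0 br]; rewrite /exp_series subr_ge0 br muleC.
    rewrite -nneseriesZl; last first.
      move=> m _; rewrite lee_fin !mulr_ge0// ?expR_ge0// ?invr_ge0// exprn_ge0//.
      by rewrite subr_ge0.
    apply: eq_eseriesr => m _; rewrite -EFinM exponential_pdfE// /h.
    congr (_%:E).
    have -> : expR (- lam * (r - b)) = expR (- lam * r) * expR ((lam - q) * b) * expR (q * b).
      by rewrite -!expRD; congr expR; ring.
    have -> : expR (- q * b) = (expR (q * b))^-1 by rewrite -expRN mulNr.
    have e0 : expR (q * b) != 0 by rewrite gt_eqF ?expR_gt0.
    have f0 : m`!%:R != 0 :> R by rewrite pnatr_eq0 -lt0n fact_gt0.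
    by field; rewrite ?e0 ?f0.
  move=> /negP; rewrite inE/= in_itv/= => /negP; rewrite negb_and -!ltNge => /orP[b0|rb].
    by rewrite lt0_exponential_pdf// mule0.
  by rewrite /exp_series ifF ?mul0e//; apply/negbTE; rewrite -ltNge subr_lt0.
have h0 m b : `[0, r]%classic b -> (0 <= h m b)%E.
  rewrite /= in_itv/= => /andP[b0 br].
  rewrite lee_fin !mulr_ge0// ?expR_ge0 ?(ltW q0)// ?invr_ge0// exprn_ge0//.
  by rewrite subr_ge0.
have mh m : measurable_fun setT (fun b : RR => expR ((lam - q) * b) * ((r - b) ^+ m / m`!%:R)).
  apply: measurable_funM.
    by apply: measurableT_comp => //; exact: measurable_funM.
  apply: measurable_funM => //; apply: measurable_funX; exact: measurable_funB.
rewrite integral_nneseries//; last first.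
  by move=> m; apply/measurable_EFinP/measurable_funTS/measurable_funM.
transitivity (\sum_(m <oo) \sum_(k <oo) ((expR (- lam * r) * q * c m) *
   ((lam - q) ^+ k * (r ^+ (k + m.+1) / (k + m.+1)`!%:R)))%:E)%E.
  apply: eq_eseriesr => m _.
  rewrite /h; under eq_integral do rewrite EFinM.
  rewrite ge0_integralZl//; last 3 first.
  - exact/measurable_EFinP/measurable_funTS.
  - move=> b; rewrite /= in_itv/= => /andP[b0 br].
    rewrite lee_fin !mulr_ge0// ?expR_ge0// ?invr_ge0// exprn_ge0//.
    by rewrite subr_ge0.
  - by rewrite lee_fin !mulr_ge0// ?expR_ge0// (ltW q0).
  rewrite integral_expR_monomial// ?subr_gt0// -nneseriesZl// => k _.
  by rewrite lee_fin !mulr_ge0// ?invr_ge0// ?exprn_ge0// subr_ge0 ltW.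
(* Here [l] is the degree [k + m.+1] in [r], so that [l.-1 - m] is [k]. *)
pose f m l := ((expR (- lam * r) * q * c m) *
   ((lam - q) ^+ (l.-1 - m) * (r ^+ l / l`!%:R)))%:E.
transitivity (\sum_(m <oo) \sum_(k <oo) f m (k + m.+1)%N)%E.
  by do 2![apply: eq_eseriesr => ? _]; rewrite /f addnS/= addnK.
rewrite nneseries_triangle; last first.
  move=> m l; rewrite lee_fin !mulr_ge0// ?expR_ge0 ?(ltW q0)// ?invr_ge0// ?exprn_ge0//.
  by rewrite subr_ge0 ltW.
apply: eq_eseriesr => l _; rewrite sumEFin; congr (_%:E).
rewrite /exp_conv_coef mulrA [in RHS]mulr_sumr; apply: eq_bigr => j _; ring.
Qed.

(** The series sums to e^((lam - q) r) and [lam] cancels: geometric coefficients encode an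
    exponential tail. *)
Lemma exp_series_geom lam q r : 0 <= r -> q <= lam ->
  exp_series lam (fun m => (lam - q) ^+ m) r = (expR (- q * r))%:E.
Proof.
move=> r0 qlam; rewrite /exp_series r0.
have -> : expR (- q * r) = expR (- lam * r) * expR ((lam - q) * r).
  by rewrite -expRD; congr expR; ring.
under eq_eseriesr do rewrite -mulrA EFinM.
rewrite nneseriesZl; last first.
  move=> m _; rewrite lee_fin !mulr_ge0// ?invr_ge0// exprn_ge0//.
  by rewrite subr_ge0.
rewrite EFinM; congr (_ * _)%E.
apply/cvg_lim => //; apply/fine_cvgP; split; first by apply: nearW => n; rewrite sumEFin.
have := @is_cvg_series_exp_coeff R ((lam - q) * r).
rewrite -/(expR _); apply: cvg_trans; apply: near_eq_cvg; apply: nearW => n /=.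
rewrite sumEFin/= /series/=; apply: eq_bigr => i _; rewrite exp_coeffE/= exprMn; ring.
Qed.

End exponential_law.

(** The generating series is z^n q_0 ... q_(n-1) divided by the product over i <= n of 1 - (lam -
    q_i) z. For rates in (0, lam), [exp_series lam (jump_coef lam n q) t] is the probability that
    independent exponential times S_i of rates [q i] satisfy S_0 + ... + S_(n-1) <= t < S_0 + ... +
    S_n. *)
Fixpoint jump_coef (R : realType) (lam : R) (n : nat) (q : nat -> R) : nat -> R :=
  if n is n'.+1 then
    exp_conv_coef lam (q 0%N) (jump_coef lam n' (fun i => q i.+1))
  else fun m => (lam - q 0%N) ^+ m.

(** * Probability of a given number of renewals before time t *)

Section renewal.
Context (R : realType).
Notation RR := (measurableTypeR R).

Lemma jump_coef_ge0 (lam : R) n (q : nat -> R) :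
  (forall i, 0 < q i < lam) -> forall m, 0 <= jump_coef lam n q m.
Proof.
elim: n q => [|n IH] q hq m /=.
  by rewrite exprn_ge0// subr_ge0 ltW//; have /andP[] := hq 0%N.
have /andP[q0 q1] := hq 0%N.
rewrite /exp_conv_coef mulr_ge0// ?(ltW q0)// sumr_ge0// => j _.
by rewrite mulr_ge0// ?exprn_ge0 ?subr_ge0 ?(ltW q1)//; exact: IH.
Qed.

Context d (T : measurableType d).

Lemma measurable_all_in (Z : nat -> T -> RR) (n : nat) (B : nat -> set R) :
  (forall i, measurable_fun setT (Z i)) -> (forall i, measurable (B i)) ->
  measurable [set s | forall i, (i <= n)%N -> B i (Z i s)].
Proof.
move=> mZ mB.
rewrite (_ : [set s | _] = \bigcap_(i in [set i | (i <= n)%N]) (Z i @^-1` B i))//.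
apply: bigcap_measurable => [|i _]; first by exists 0%N.
exact: measurable_preimageT (mZ i) _ (mB i).
Qed.

(* Conditioning on Z 0 turns the case n.+1 for U into the case n for U + Z 0,
   so the kernel for n.+1 jumps is the convolution of the law of Z 0 with the
   kernel for n jumps. *)
Lemma measure_renewal (lam t : R) (n : nat) (m : {measure set T -> \bar R})
    (U : T -> RR) (Z : nat -> T -> RR) (q : nat -> R) :
  measurable_fun setT U -> (forall i, measurable_fun setT (Z i)) ->
  (m setT < +oo)%E -> (forall i, 0 < q i < lam) ->
  (forall A (B : nat -> set R), measurable A -> (forall i, measurable (B i)) ->
    m (U @^-1` A `&` [set s | forall i, (i <= n)%N -> B i (Z i s)]) =
    m (U @^-1` A) * \prod_(i < n.+1) exponential_prob (q i) (B i))%E ->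
  m [set s | U s + \sum_(i < n) Z i s <= t < U s + \sum_(i < n.+1) Z i s] =
  (\int[m]_s exp_series lam (jump_coef lam n q) (t - U s))%E.
Proof.
elim: n U Z q => [|n IH] U Z q mU mZ mfin hq indep.
  have /andP[q0 qlam] := hq 0%N.
  pose E : set (RR * RR) := [set z | z.1 <= t < z.1 + z.2].
  have mE : measurable E.
    have -> : E = [set z | z.1 <= t] `&` [set z | t < z.1 + z.2].
      apply/seteqP; split => z; rewrite /E/=; first by move=> /andP[].
      by move=> [h1 h2]; apply/andP.
    apply: measurableI.
      by apply: measurable_ler => //; exact: measurable_fst.
    apply: measurable_ltr => //.
    by apply: measurable_funD.
  have E1 : (\int[m]_s (\1_E (U s, Z 0%N s))%:E =
             \int[m]_s \int[exp_law q0]_b (\1_E (U s, b))%:E)%E.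
    rewrite (@ge0_integral_indep _ T R m m 1%:nng U (Z 0%N) (exp_law q0)
      (fun z => (\1_E z)%:E))//= ?mul1e//.
      move=> A B mA mB; rewrite mul1e.
      have := indep A (fun=> B) mA (fun=> mB).
      rewrite big_ord1 => <-; congr (m (_ `&` _)).
      apply/seteqP; split => s /=; last by move=> /(_ 0%N); exact.
      by move=> Bs [].
    exact/measurable_EFinP/measurable_indic.
  transitivity (\int[m]_s (\1_E (U s, Z 0%N s))%:E)%E.
    have mUZ : measurable_fun setT (fun s => (U s, Z 0%N s)).
      by apply/measurable_fun_pairP; split => //=; exact: (mZ 0%N).
    have mEE := measurable_preimageT mUZ mE.
    transitivity (m [set s | E (U s, Z 0%N s)]).
      by congr (m _); apply/seteqP; split => s /=; rewrite /E/= big_ord0 addr0 big_ord1.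
    rewrite -[X in m X]setIT -integral_indic//.
  rewrite E1; apply: eq_integral => s _.
  (* If [U s <= t], the event says that [Z 0] exceeds [t - U s], an exponential tail; otherwise both
     sides vanish. *)
  have [Ut|tU] := leP (U s) t; last first.
    rewrite integral0_eq; last first.
      by move=> b _; rewrite indicE memNset// /E/= leNgt tU.
    by rewrite /exp_series ifF// subr_ge0 leNgt tU.
  have tail : measurable (`]t - U s, +oo[%classic : set RR) by exact: measurable_itv.
  rewrite exp_series_geom ?subr_ge0 ?(ltW qlam)// -exp_prob_tail ?subr_ge0//.
  transitivity (\int[exp_law q0]_b (\1_(`]t - U s, +oo[%classic) b)%:E)%E.
    apply: eq_integral => b _; rewrite !indicE; congr (_%:R%:E).
    have EE : E (U s, b) = (`]t - U s, +oo[%classic : set RR) b.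
      by rewrite /E/= in_itv/= andbT Ut ltrBlDl.
    by have [h|h] := pselect (E (U s, b)); [rewrite !mem_set// -EE|rewrite !memNset// -EE].
  by rewrite integral_indic// setIT.
have /andP[q0 qlam] := hq 0%N.
pose U' s : RR := U s + Z 0%N s.
have mU' : measurable_fun setT U' by apply: measurable_funD => //; exact: (mZ 0%N).
have prodT k (q' : nat -> R) : (forall i, 0 < q' i < lam) ->
    (\prod_(i < k) exponential_prob (q' i) setT = 1)%E.
  move=> hq'; rewrite big1// => i _; have /andP[qi0 _] := hq' i.
  exact: (probability_setT (exp_law qi0)).
have indep0 A B : measurable A -> measurable B ->
    m (U @^-1` A `&` Z 0%N @^-1` B) = (1%:nng%:num%:E * m (U @^-1` A) * exp_law q0 B)%E.
  move=> mA mB; rewrite mul1e.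
  have := indep A (fun i => if i is 0%N then B else setT) mA _.
  rewrite big_ord_recl [X in (_ * (_ * X))%E](prodT n.+1 (fun i => q i.+1) (fun i => hq i.+1)).
  rewrite mule1 => <-; last by case.
  congr (m (_ `&` _)); apply/seteqP; split => s /=; first by move=> Bs [].
  by move=> /(_ 0%N); exact.
have conv (F : RR -> \bar R) : measurable_fun setT F -> (forall x, 0 <= F x)%E ->
    (\int[m]_s F (U' s) = \int[m]_s \int[exp_law q0]_b F (U s + b)%R)%E.
  move=> mF F0.
  rewrite (@ge0_integral_indep _ T R m m 1%:nng U (Z 0%N) (exp_law q0)
    (fun z => F (z.1 + z.2)))//= ?mul1e//.
  have mD : measurable_fun setT (fun z : RR * RR => (z.1 + z.2 : RR)).
    by apply: measurable_funD.
  exact: (measurableT_comp mF mD).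
have mS := @measurable_exp_series R lam _ (@jump_coef_ge0 lam n _ (fun i => hq i.+1)).
transitivity (\int[m]_s exp_series lam (jump_coef lam n (fun i => q i.+1)) (t - U' s))%E.
  rewrite -(IH U' (fun i => Z i.+1) (fun i => q i.+1))//; last first.
    (* The induction hypothesis requires [U'] to be independent of the later times. Restricting [m]
       to the event [D] about them multiplies the joint law of [U] and [Z 0] by the constant [c],
       hence also the law of their sum. *)
    move=> A B mA mB; set D := [set s | _].
    have mD : measurable D by exact: (measurable_all_in n (fun i => mZ i.+1) mB).
    pose c := \prod_(i < n.+1) fine (exponential_prob (q i.+1) (B i)).
    have cE : (\prod_(i < n.+1) exponential_prob (q i.+1) (B i) = c%:E)%E.
      rewrite /c -prodEFin; apply: eq_bigr => i _.
      have /andP[qi0 _] := hq i.+1.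
      by rewrite fineK//; exact: (fin_num_measure (exp_law qi0) _ (mB i)).
    have c0 : 0 <= c.
      apply: prodr_ge0 => i _; have /andP[qi0 _] := hq i.+1.
      by apply: fine_ge0; exact: (measure_ge0 (exp_law qi0)).
    have indepD A' B' : measurable A' -> measurable B' ->
        mrestr m mD (U @^-1` A' `&` Z 0%N @^-1` B') =
        ((NngNum c0)%:num%:E * m (U @^-1` A') * exp_law q0 B')%E.
      move=> mA' mB'; rewrite /= -cE.
      have := indep A' (fun i => if i is j.+1 then B j else B') mA' _.
      rewrite big_ord_recl => indep'.
      rewrite -muleA muleC -muleA; apply: etrans (indep' _); last by case.
      rewrite /mrestr -setIA; congr (m (_ `&` _)).
      apply/seteqP; split => s /= => [[B's Ds] [|i]//|h].
        exact: Ds.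
      by split => [|i ile]; [exact: (h 0%N)|exact: (h i.+1)].
    pose F (z : RR * RR) := (\1_A (z.1 + z.2))%:E : \bar R.
    have mF : measurable_fun setT F.
      have mA1 : measurable_fun setT (fun x : RR => (\1_A x)%:E : \bar R).
        exact/measurable_EFinP/measurable_indic.
      have mDD : measurable_fun setT (fun z : RR * RR => (z.1 + z.2 : RR)).
        by apply: measurable_funD.
      exact: (measurableT_comp mA1 mDD).
    have F0 z : (0 <= F z)%E by rewrite lee_fin.
    have mU'A := measurable_preimageT mU' mA.
    have -> : m (U' @^-1` A `&` D) = (\int[mrestr m mD]_s F (U s, Z 0%N s))%E.
      rewrite /F/= -[LHS]/(mrestr m mD (U' @^-1` A)) -[X in mrestr _ _ X]setIT.
      by rewrite -integral_indic.
    have -> : m (U' @^-1` A) = (\int[m]_s F (U s, Z 0%N s))%E.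
      by rewrite /F/= -[X in m X]setIT -integral_indic.
    rewrite (ge0_integral_indep mU (mZ 0%N) mfin indepD mF F0).
    by rewrite (ge0_integral_indep mU (mZ 0%N) mfin indep0 mF F0) /= mul1e cE muleC.
  have sumE k s : U s + \sum_(i < k.+1) Z i s = U' s + \sum_(i < k) Z i.+1 s.
    by rewrite big_ord_recl addrA.
  by congr (m _); apply/seteqP; split => s /=; rewrite !sumE.
have mB : measurable_fun setT (fun u : RR => t - u : RR) by exact: measurable_funB.
have mSB := measurableT_comp mS mB.
rewrite (conv _ mSB); last first.
  by move=> x; apply: exp_series_ge0; apply: jump_coef_ge0 => i; exact: hq.
apply: eq_integral => s _ /=.
under eq_integral do rewrite opprD addrA.
rewrite integral_exp_law_series//.
by apply: jump_coef_ge0 => i; exact: hq.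
Qed.
End renewal.

(** * The jump chain along a fixed path *)

Lemma measureI_ae d (T : measurableType d) (R : realType)
    (m : {measure set T -> \bar R}) (A E : set T) :
  measurable A -> measurable E -> m (A `\` E) = 0%E -> m (A `&` E) = m A.
Proof.
by move=> mA mE mAE; rewrite [RHS](measureDI m mA mE) [X in (X + _)%E]mAE add0e.
Qed.

(** The exponential law charges only positive times, so that holding times may later be taken
    positive. *)
Lemma exp_prob_gt0 (R : realType) (q : R) (A : set R) : 0 < q -> measurable A ->
  exponential_prob q (A `&` `]0, +oo[) = exponential_prob q A.
Proof.
move=> q0 mA; have m0 : measurable (`]0, +oo[%classic : set R) by exact: measurable_itv.
apply: (@measureI_ae _ _ _ (exp_law q0) A) => //.
apply/eqP; rewrite -measure_le0.
have <- : exp_law q0 (~` `]0, +oo[) = 0%E.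
  rewrite probability_setC//= exp_prob_tail// mulr0 expR0 subee//.
by apply: (le_measure (exp_law q0)); rewrite ?inE;
  [exact: measurableD|exact: measurableC|move=> x []].
Qed.

Section path.
Context (R : realType) (d : nat) (w : environment R d) (x : lattice d).
Context (c : chain w x).
Notation P := (chain_prob c).
Notation T := (chain_space c).

(** Every partial sum up to the n-th is bounded, not only the last one: holding times are positive
    only almost surely, and [position] takes the least index. *)
Definition jumps_at (t : R) (n : nat) : set T :=
  [set s | (forall i, (i < n)%N -> jump_time i.+1 s <= t) /\
           t < jump_time n.+1 s].

Lemma measurable_jump_time n : measurable_fun setT (@jump_time _ _ _ _ c n).
Proof. by apply: measurable_sum => i; exact: measurable_holding. Qed.

Lemma measurable_jumps_at t n : measurable (jumps_at t n).
Proof.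
rewrite (_ : jumps_at t n = (\bigcap_(i in [set i | (i < n)%N])
    [set s | jump_time i.+1 s <= t]) `&` [set s | t < jump_time n.+1 s]) //.
apply: measurableI.
  have [->|n0] := eqVneq n 0%N.
    by rewrite (_ : [set i | _] = set0) ?bigcap_set0//; apply/seteqP; split.
  apply: bigcap_measurable => [|i _]; first by exists 0%N; rewrite /= lt0n.
  by apply: measurable_ler => //; exact: measurable_jump_time.
by apply: measurable_ltr => //; exact: measurable_jump_time.
Qed.

Lemma measurable_sites (y : nat -> lattice d) n :
  measurable [set s : T | forall i, (i < n)%N -> site i s = y i].
Proof.
have [->|n0] := eqVneq n 0%N.
  by rewrite (_ : [set s | _] = setT)//; apply/seteqP; split.
rewrite (_ : [set s | _] = (\bigcap_(i in [set i | (i < n)%N])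
    (@site _ _ _ _ c i @^-1` [set y i])))//.
apply: bigcap_measurable => [|i _]; first by exists 0%N; rewrite /= lt0n.
exact: measurable_site.
Qed.

(** Restricted to the prescribed sites, [chain_prob] makes the holding times independent
    exponentials, with total mass the weight of the path; [measure_renewal] then applies. *)
Lemma measure_path (lam t : R) (n : nat) (y : nat -> lattice d) :
  0 <= t -> (forall i, 0 < exit_rate w (y i) < lam) ->
  P (jumps_at t n `&` [set s | forall i, (i < n.+1)%N -> site i s = y i]) =
  (((y 0%N == x)%:R * \prod_(i < n) jump_prob w (y i) (y i.+1))%:E *
   exp_series lam (jump_coef lam n (fun i => exit_rate w (y i))) t)%E.
Proof.
move=> t0 hq; set G := [set s | _].
have mG : measurable G by exact: measurable_sites.
have mJ := measurable_jumps_at t n.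
set C := (_ * _)%:E; pose q i := exit_rate w (y i).
have mpos : measurable (`]0, +oo[%classic : set R) by exact: measurable_itv.
have law (B : nat -> set R) : (forall i, measurable (B i)) ->
    P [set s | forall i, (i <= n)%N ->
         site i s = y i /\ (B i `&` `]0, +oo[%classic) (holding i s)] =
    (C * \prod_(i < n.+1) exponential_prob (q i) (B i))%E.
  move=> mB; have := chain_law c n y (fun i => measurableI _ _ (mB i) mpos).
  move=> ->; rewrite -EFinM; congr (_ * _)%E; apply: eq_bigr => i _.
  by apply: exp_prob_gt0 => //; have /andP[] := hq i.
have law' (B : nat -> set R) : (forall i, measurable (B i)) ->
    P [set s | forall i, (i <= n)%N -> site i s = y i /\ B i (holding i s)] =
    (C * \prod_(i < n.+1) exponential_prob (q i) (B i))%E.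
  by move=> mB; rewrite chain_law// -EFinM.
have prodT : (\prod_(i < n.+1) exponential_prob (q i) setT = 1)%E.
  rewrite big1// => i _; have /andP[qi0 _] := hq i.
  exact: (probability_setT (exp_law qi0)).
(* On [Gp] the jump times increase, so of the upper bounds in [jumps_at] only the last matters; [Gp]
   has the same probability as [G]. *)
pose Gp := G `&` [set s | forall i, (i <= n)%N -> (`]0, +oo[%classic : set R) (holding i s)].
have mpos' : measurable [set s : T | forall i, (i <= n)%N ->
    (`]0, +oo[%classic : set R) (holding i s)].
  by apply: (@measurable_all_in R _ T (fun i => @holding _ _ _ _ c i) n
    (fun=> `]0, +oo[%classic)) => // i; exact: measurable_holding.
have mGp : measurable Gp by exact: measurableI.
have GE (B : nat -> set R) : G `&` [set s | forall i, (i <= n)%N -> B i (holding i s)] =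
    [set s | forall i, (i <= n)%N -> site i s = y i /\ B i (holding i s)].
  apply/seteqP; split => [s [Gs Bs] i ile|s h]; first by split; [exact: Gs|exact: Bs].
  by split => [i ile|i ile]; have [] := h i ile.
have PG : P G = C.
  have := law' (fun=> setT) (fun=> measurableT); rewrite prodT mule1 => <-.
  by congr (P _); apply/seteqP; split => s h i ile; [split => //; exact: h|have [] := h i ile].
have PGp : P Gp = C.
  rewrite /Gp (GE (fun=> `]0, +oo[%classic)).
  have := law (fun=> setT) (fun=> measurableT); rewrite prodT mule1 => <-.
  by congr (P _); apply/seteqP; split => s h i ile; have := h i ile; rewrite setTI.
have PJ : P (jumps_at t n `&` G) = P (jumps_at t n `&` Gp).
  rewrite /Gp setIA; apply/esym/measureI_ae => //; first exact: measurableI.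
  apply/eqP; rewrite -measure_le0.
  have <- : P (G `\` Gp) = 0%E.
    rewrite measureD//; last first.
      by rewrite -ge0_fin_numE ?measure_ge0//; exact: fin_num_measure.
    have GGp : G `&` Gp = Gp by rewrite /Gp setIA setIid.
    by rewrite GGp; rewrite [X in (X - _)%E]PG [X in (_ - X)%E]PGp subee.
  apply: (le_measure P); rewrite ?inE; [|exact: measurableD|].
    by apply: measurableD => //; exact: measurableI.
  by move=> s [[Js Gs] h]; split => // -[_] /h.
rewrite PJ.
pose m : {measure set T -> \bar R} := mrestr P mGp.
have -> : P (jumps_at t n `&` Gp) =
    m [set s | 0 + \sum_(i < n) holding i s <= t < 0 + \sum_(i < n.+1) holding i s].
  rewrite /m /= /mrestr; congr (P _); apply/seteqP; split => s [h Gps]; split => //=.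
    case: h => h1 h2; rewrite !add0r; apply/andP; split => //.
    have [n0|n0] := posnP n.
      by rewrite big1// => i _; have := ltn_ord i; rewrite {2}n0.
    have := h1 n.-1; rewrite prednK//; exact.
  move: h; rewrite /= !add0r => /andP[h1 h2]; split => // i ilt.
  apply: le_trans h1; rewrite /jump_time -(subnKC ilt) big_split_ord/= lerDl.
  apply: sumr_ge0 => j _; case: Gps => _ /(_ (i.+1 + j)%N); rewrite /= in_itv/= andbT => H.
  by apply/ltW/H; rewrite -leq_subRL// ltnW.
have mfin : (m setT < +oo)%E.
  by rewrite /m /= /mrestr setTI -ge0_fin_numE ?measure_ge0//; exact: fin_num_measure.
(* The starting time [U] is the constant 0, so its independence is checked according to whether [A]
   contains 0. *)
rewrite (@measure_renewal R _ T lam t n m (fun=> 0) (fun i => @holding _ _ _ _ c i) q)//.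
- rewrite subr0 integral_cst//=.
  by rewrite /mrestr setTI PGp muleC.
- by move=> i; exact: measurable_holding.
move=> A B mA mB; have [A0|A0] := pselect (A 0).
  rewrite (_ : _ @^-1` A = setT); last by apply/seteqP; split.
  rewrite setTI /m /= /mrestr setTI PGp -law//; congr (P _).
  apply/seteqP; split => [s [h1 [Gs h2]] i ile|s h].
    by split; [exact: Gs|split; [exact: h1|exact: h2]].
  by split => [i ile|]; [have [_ []] := h i ile|split => i ile; have [? []] := h i ile].
rewrite (_ : _ @^-1` A = set0); last by apply/seteqP; split.
by rewrite set0I measure0 mul0e.
Qed.
End path.

(** * Monotonicity of traces *)

Section trace.
Context (R : realType) (k : nat).
Implicit Types (A B D E : 'M[R]_k) (v : 'cV[R]_k).

Definition psd A := A^T = A /\ forall v, 0 <= (v^T *m A *m v) 0 0.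

(** A^n = H B H with H = A^(n/2), rounded down, and B either [A] or the identity; as H is symmetric,
    the form of [A ^+ n] at v is that of B at Hv. *)
Lemma psdX A n : psd A -> psd (A ^+ n).
Proof.
move=> [sA pA].
have sAn j : (A ^+ j)^T = A ^+ j.
  elim: j => [|j IH]; first by rewrite expr0 trmx1.
  by rewrite [in LHS]exprS trmx_mul IH sA exprSr.
split=> // v.
have sandwich H B : H^T = H -> (forall u : 'cV_k, 0 <= (u^T *m B *m u) 0 0) ->
    0 <= (v^T *m (H *m B *m H) *m v) 0 0.
  by move=> sH /(_ (H *m v)); rewrite trmx_mul sH !mulmxA.
have -> : A ^+ n = A ^+ n./2 *m A ^+ odd n *m A ^+ n./2.
  by rewrite -[RHS]/(A ^+ n./2 * A ^+ odd n * A ^+ n./2) -!exprD addnAC addnn addnC odd_double_half.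
apply: sandwich => // u; case: (odd n); first by rewrite expr1.
by rewrite expr0 mulmx1 mxE sumr_ge0// => i _; rewrite mxE -expr2 sqr_ge0.
Qed.

Lemma psd_convex A B (a b : R) : 0 <= a -> 0 <= b -> psd A -> psd B ->
  psd (a *: A + b *: B).
Proof.
move=> a0 b0 [sA pA] [sB pB]; split.
  by rewrite linearD/= !linearZ/= sA sB.
move=> v; rewrite mulmxDr mulmxDl -!scalemxAr -!scalemxAl !mxE.
by have := pA v; have := pB v; rewrite !mxE => h1 h2; rewrite addr_ge0// mulr_ge0.
Qed.

(** The form is evaluated at the basis vector e_i and at e_i - e_j. *)
Lemma psd_entries E i j : psd E -> 0 <= E i i /\ 2 * E i j <= E i i + E j j.
Proof.
move=> [sE pE].
have e (i' j' : 'I_k) :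
    ((delta_mx i' 0 : 'cV[R]_k)^T *m E *m (delta_mx j' 0 : 'cV[R]_k)) 0 0 = E i' j'.
  by rewrite trmx_delta -rowE -colE !mxE.
split; first by rewrite -e.
have := pE (delta_mx i 0 - delta_mx j 0).
have sub (B C : 'M[R]_1) : (B - C) 0 0 = B 0 0 - C 0 0 by rewrite !mxE.
rewrite [(_ - _)^T]linearB/= mulmxBr !mulmxBl !sub !e.
have -> : E j i = E i j by rewrite -{1}sE mxE.
move=> h; rewrite -subr_ge0; apply: le_trans h _.
by rewrite le_eqVlt; apply/orP; left; apply/eqP; ring.
Qed.

(* The derivative of s |-> tr (A + s D)^m is m tr (D (A + s D)^(m-1)). *)
Lemma mxtrace_exp_le A D m :
  (forall s, 0 <= s -> s <= 1 -> psd (A + s *: D)) ->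
  (forall E, psd E -> 0 <= \tr (D *m E)) ->
  \tr (A ^+ m) <= \tr ((A + D) ^+ m).
Proof.
move=> hpsd hD.
(* With s as a polynomial variable the trace becomes a polynomial [p], its derivative is formal, and
   the mean value theorem for polynomials compares [p] at 0 and at 1. *)
pose M : 'M[{poly R}]_k := map_mx polyC A + 'X *: map_mx polyC D.
pose p := \tr (M ^+ m).
have evM s n : map_mx (horner_eval s) (M ^+ n) = (A + s *: D) ^+ n.
  elim: n => [|n IH]; first by rewrite !expr0 map_mx1.
  rewrite !exprS map_mxM IH; congr (_ *m _).
  apply/matrixP => i j; rewrite !mxE/= /horner_eval.
  by rewrite hornerD hornerM hornerX !hornerC.
have evp s (B : 'M[{poly R}]_k) : (\tr B).[s] = \tr (map_mx (horner_eval s) B).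
  by rewrite /mxtrace horner_sum; apply: eq_bigr => i _; rewrite !mxE.
have derivmx (B C : 'M[{poly R}]_k) :
    map_mx deriv (B *m C) = map_mx deriv B *m C + B *m map_mx deriv C.
  apply/matrixP => i j; rewrite !mxE raddf_sum -big_split/=; apply: eq_bigr => l _.
  by rewrite !mxE derivM.
have dM : map_mx deriv M = map_mx polyC D.
  by apply/matrixP => i j; rewrite !mxE derivD derivC derivM derivX derivC mul1r mulr0 addr0 add0r.
have dtr (B : 'M[{poly R}]_k) : (\tr B)^`() = \tr (map_mx deriv B).
  by rewrite /mxtrace raddf_sum; apply: eq_bigr => i _; rewrite !mxE.
(* The trailing factor [M ^+ C] strengthens the induction: it absorbs the factor that cyclicity of
   the trace moves to the end. *)
have dX n (C : nat) : \tr (map_mx deriv (M ^+ n) *m M ^+ C) =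
    \tr (map_mx polyC D *m M ^+ (n + C).-1) *+ n.
  elim: n C => [|n IH] C.
    rewrite expr0 mulr0n (_ : map_mx deriv 1 = 0) ?mul0mx ?mxtrace0//.
    by apply/matrixP => i j; rewrite !mxE -polyC_natr derivC.
  rewrite exprS derivmx dM mulmxDl mxtraceD -mulmxA -[M ^+ n *m _]exprD.
  have cyc (X Y : 'M[{poly R}]_k) : \tr (M *m X *m Y) = \tr (X *m (Y *m M)).
    by rewrite -mulmxA mxtrace_mulC mulmxA.
  by rewrite cyc -[_ *m M]exprSr IH addnS addSn mulrS.
have dp s : 0 < s < 1 -> 0 <= p^`().[s].
  move=> /andP[s0 s1]; have := dX m 0%N.
  rewrite expr0 [_ *m 1]mulmx1 addn0 -dtr -/p => ->; rewrite hornerMn.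
  rewrite mulrn_wge0// evp map_mxM evM.
  have -> : map_mx (horner_eval s) (map_mx polyC D) = D.
    by apply/matrixP => i j; rewrite !mxE /horner_eval hornerC.
  by apply: hD; apply: psdX; apply: hpsd; exact: ltW.
have -> : \tr (A ^+ m) = p.[0] by rewrite evp evM scale0r addr0.
have -> : \tr ((A + D) ^+ m) = p.[1] by rewrite evp evM scale1r.
have [c hc] := polyrcf.poly_mvt p (@ltr01 R).
rewrite subr0 mulr1 -subr_ge0 => ->; apply: dp.
by move: hc; rewrite in_itv.
Qed.
End trace.

(** * Summation over the paths in a finite set *)

Lemma big_tuple_cons (V : nmodType) (I : finType) n (F : seq I -> V) :
  \sum_(p : n.+1.-tuple I) F p = \sum_i \sum_(p : n.-tuple I) F (i :: p).
Proof.
rewrite pair_big/= (reindex (fun ip : I * n.-tuple I => [tuple of ip.1 :: ip.2]))//=.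
exists (fun p : n.+1.-tuple I => (thead p, [tuple of behead p])) => [[i p] _|p _] /=.
  by congr pair; apply: val_inj.
by apply: val_inj; rewrite /= [in RHS](tuple_eta p).
Qed.

Section exp_series_sum.
Context (R : realType).

Lemma exp_series_sum (I : finType) (lam t : R) (v : I -> R) (c : I -> nat -> R) :
  (forall i, 0 <= v i) -> (forall i m, 0 <= c i m) ->
  (\sum_i (v i)%:E * exp_series lam (c i) t =
   exp_series lam (fun m => \sum_i v i * c i m)%R t)%E.
Proof.
move=> v0 c0; rewrite /exp_series; case: ifPn => t0; last first.
  by rewrite big1// => i _; rewrite mule0.
have u0 m : 0 <= expR (- lam * t) * (t ^+ m / m`!%:R).
  by rewrite mulr_ge0 ?expR_ge0// mulr_ge0// ?invr_ge0// exprn_ge0.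
under eq_bigr => i _.
  rewrite -nneseriesZl; last by move=> m _; rewrite lee_fin mulr_ge0.
  over.
rewrite -nneseries_sum; last first.
  by move=> i m _; rewrite -EFinM lee_fin; apply: mulr_ge0 => //; apply: mulr_ge0.
apply: eq_eseriesr => m _; rewrite mulr_sumr -sumEFin.
by apply: eq_bigr => i _; rewrite -EFinM mulrCA mulrA.
Qed.

(** After exchanging the two sums, the partial sums over n in degree m are constant from m + 1 terms
    on. *)
Lemma nneseries_exp_series (lam t : R) (a : nat -> nat -> R) (b : nat -> R) :
  (forall n m, 0 <= a n m) ->
  (forall m N, (m < N)%N -> \sum_(n < N) a n m = b m) ->
  (\sum_(n <oo) exp_series lam (a n) t = exp_series lam b t)%E.
Proof.
move=> a0 ab; rewrite /exp_series; case: ifPn => t0; last by rewrite eseries0.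
have u0 m : 0 <= expR (- lam * t) * (t ^+ m / m`!%:R).
  by rewrite mulr_ge0 ?expR_ge0// mulr_ge0// ?invr_ge0// exprn_ge0.
rewrite nneseries_interchange; last by move=> n m; rewrite lee_fin mulr_ge0.
apply: eq_eseriesr => m _; apply/cvg_lim => //.
apply: (@cvg_near_cst _ _ _ _ \oo); near=> N.
rewrite big_mkord sumEFin -mulr_sumr ab//.
by near: N; exact: nbhs_infty_gt.
Unshelve. all: by end_near. Qed.

End exp_series_sum.

(** * The killed chain and the exponential of its generator *)

Section stay.
Context (R : realType) (d k : nat) (w : environment R d) (x : lattice d).
Context (e : 'I_k -> lattice d) (o : 'I_k).

(* lam + G, for G the generator of the chain killed outside the range of e *)
Definition killed_mx (lam : R) : 'M[R]_k :=
  \matrix_(i, j) ((i == j)%:R * (lam - exit_rate w (e i)) + w (e i) (e j)).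

Context (lam t : R) (t0 : 0 <= t).
Hypothesis rates : forall i, 0 < exit_rate w (e i) < lam.

Notation q i := (exit_rate w (e i)).
Notation J i j := (jump_prob w (e i) (e j)).

(** The sequence [p] lists the indices of n + 1 sites, and the indicator makes the path end at
    [o]. *)
Let path_weight n (p : seq 'I_k) : R :=
  (nth o p n == o)%:R * \prod_(j < n) J (nth o p j) (nth o p j.+1).

(** The coefficient of degree [m] contributed by all paths of [n] jumps from [i] to [o] inside the
    range of [e]. *)
Let a n m i := \sum_(p : n.-tuple 'I_k)
  path_weight n (i :: p) * jump_coef lam n (fun j => q (nth o (i :: p) j)) m.

Let J_ge0 i j : 0 <= J i j.
Proof. by rewrite divr_ge0 ?conductance_ge0// ltW//; have /andP[] := rates i. Qed.

Let path_weight_ge0 n p : 0 <= path_weight n p.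
Proof. by rewrite mulr_ge0// prodr_ge0. Qed.

Let coef_ge0 n p m : 0 <= jump_coef lam n (fun j => q (nth o p j)) m.
Proof. by apply: jump_coef_ge0 => j; exact: rates. Qed.

Let a_ge0 n m i : 0 <= a n m i.
Proof. by apply: sumr_ge0 => p _; rewrite mulr_ge0. Qed.

Let a0 m i : a 0 m i = (i == o)%:R * (lam - q i) ^+ m.
Proof.
rewrite /a (big_pred1 [tuple]); last by move=> p; apply/esym/eqP; exact: tuple0.
by rewrite /path_weight/= big_ord0 mulr1.
Qed.

Let aS n m i :
  a n.+1 m i = exp_conv_coef lam (q i) (fun l => \sum_j J i j * a n l j) m.
Proof.
rewrite /a (big_tuple_cons n (fun p => path_weight n.+1 (i :: p) *
  jump_coef lam n.+1 (fun j => q (nth o (i :: p) j)) m)) /exp_conv_coef.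
under [in RHS]eq_bigr do rewrite mulr_sumr.
rewrite [in RHS]exchange_big/= mulr_sumr; apply: eq_bigr => j _.
under [in RHS]eq_bigr do rewrite mulrCA mulr_sumr mulr_sumr.
rewrite [in RHS]exchange_big/= mulr_sumr; apply: eq_bigr => p _.
have -> : path_weight n.+1 [:: i, j & p] = J i j * path_weight n (j :: p).
  by rewrite /path_weight big_ord_recl mulrCA.
rewrite /exp_conv_coef mulrCA mulr_sumr; congr (_ * _).
by apply: eq_bigr => l _; rewrite -[LHS]mulrA; congr (J i j * _); exact: mulrCA.
Qed.

(** Each jump raises the lowest degree of the series by one. *)
Let a_lt n m i : (m < n)%N -> a n m i = 0.
Proof.
elim: n m i => // n IH m i mn; rewrite aS /exp_conv_coef big1 ?mulr0// => l _.
by rewrite big1 ?mulr0// => j _; rewrite IH ?mulr0// (leq_trans (ltn_ord l)).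
Qed.

(** One more degree is either a fictitious step staying at [i], of weight [lam - q i], or a true
    jump, of weight q_i J_ij = w(e_i, e_j). These are the entries of [killed_mx]. *)
Let aSS n m i : a n.+1 m.+1 i = (lam - q i) * a n.+1 m i +
  \sum_j w (e i) (e j) * a n m j.
Proof.
rewrite !aS /exp_conv_coef big_ord_recr/= subnn expr0 mul1r mulrDr; congr (_ + _).
  rewrite mulrCA; congr (_ * _); rewrite mulr_sumr; apply: eq_bigr => l _.
  by rewrite mulrA -exprS; case: m l => [[]//|m] l /=; rewrite subSn// -ltnS.
rewrite mulr_sumr; apply: eq_bigr => j _; rewrite /jump_prob.
have /andP[q0 _] := rates i.
by field; rewrite gt_eqF.
Qed.

(** Induction on [m], expanding the power along its first factor by [aSS]. By [a_lt] the terms with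
    n > m vanish, so any [N] above [m] gives the full sum. *)
Let sum_a m N i : (m < N)%N -> \sum_(n < N) a n m i = (killed_mx lam ^+ m) i o.
Proof.
elim: m N i => [|m IH] [//|N] i mN.
  rewrite big_ord_recl a0 expr0 mulr1 big1 ?addr0 ?mxE// => n _.
  by rewrite a_lt.
(* The recursion [aSS] covers n >= 1 only; the term n = 0 is split off and rejoins the diagonal
   part. *)
rewrite big_ord_recl a0; under eq_bigr do rewrite aSS.
rewrite big_split/= -mulr_sumr exchange_big/=.
rewrite [in RHS]exprS -[killed_mx lam * _]/(killed_mx lam *m _) [RHS]mxE.
have := IH N.+1 i (ltnW mN); rewrite big_ord_recl a0/= => IHi.
rewrite exprS mulrCA addrA -mulrDr IHi.
under [RHS]eq_bigr do rewrite mxE mulrDl.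
rewrite big_split/=; congr (_ + _).
  rewrite (bigD1 i)//= eqxx mul1r big1 ?addr0// => j /negPf ji.
  by rewrite eq_sym ji !mul0r.
by apply: eq_bigr => j _; rewrite -mulr_sumr IH.
Qed.

Context (c : chain w x).
Hypotheses (e_inj : injective e) (eo : e o = x).
Notation P := (chain_prob c).

Definition stays_until (A : set (lattice d)) (n : nat) : set (chain_space c) :=
  [set s | jumps_at t n s /\ (forall i, (i < n.+1)%N -> A (site i s)) /\ site n s = x].

(** The event that X_t = x and that the chain has not left [A] by time t, split by the number of
    jumps. *)
Definition returns_within (A : set (lattice d)) : set (chain_space c) :=
  \bigcup_n stays_until A n.

Lemma stays_untilE n : stays_until (range e) n =
  \bigcup_(p in [set p : n.+1.-tuple 'I_k | nth o p n == o])
    (jumps_at t n `&` [set s | forall i, (i < n.+1)%N -> site i s = e (nth o p i)]).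
Proof.
apply/seteqP; split=> [s [Js [inA snx]]|s [p /= /eqP pn [Js sp]]]; last first.
  split=> //; split=> [i ilt|]; first by rewrite sp//; eexists.
  by rewrite sp// pn.
have [f fE] : exists f : nat -> 'I_k, forall i, (i < n.+1)%N -> site i s = e (f i).
  suff /choice[f fE] : forall i, exists j, (i < n.+1)%N -> site i s = e j by exists f.
  move=> i.
  have [/inA [j _ <-]|_] := ltnP i n.+1; first by exists j.
  by exists o.
have fnth i : (i < n.+1)%N -> nth o [tuple of mkseq f n.+1] i = f i.
  by move=> ilt; rewrite /= nth_mkseq.
exists [tuple of mkseq f n.+1].
  by rewrite /= fnth//; apply/eqP/e_inj; rewrite -fE// snx.
by split=> // i ilt; rewrite fnth// fE.
Qed.

Lemma measurable_stays_until n : measurable (stays_until (range e) n).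
Proof.
rewrite stays_untilE; apply: fin_bigcup_measurable => [|p _].
  exact: finite_finset.
by apply: measurableI; [exact: measurable_jumps_at|exact: measurable_sites].
Qed.

Lemma measure_stays_until n :
  P (stays_until (range e) n) = exp_series lam (a n ^~ o) t.
Proof.
rewrite stays_untilE measure_fin_bigcup//=; last 2 first.
- move=> p p' _ _ [s [[_ sp] [_ sp']]]; apply: val_inj; apply: (@eq_from_nth _ o).
    by rewrite !size_tuple.
  by move=> i; rewrite size_tuple => ilt; apply: e_inj; rewrite -sp// -sp'.
- by move=> p _; apply: measurableI; [exact: measurable_jumps_at|exact: measurable_sites].
transitivity (\sum_(p : n.+1.-tuple 'I_k | nth o p n == o) P (jumps_at t n `&`
    [set s | forall i, (i < n.+1)%N -> site i s = e (nth o p i)]))%E.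
  by rewrite [RHS]bigfs ?index_enum_uniq// => p _; rewrite mem_index_enum.
rewrite big_mkcond/=.
(* The first factor makes the path start at [o], the index of [x]; splitting off the first index
   below then gives [a n m o]. *)
pose v (p : n.+1.-tuple 'I_k) := (nth o p 0 == o)%:R * path_weight n p.
pose c' (p : n.+1.-tuple 'I_k) := jump_coef lam n (fun j => q (nth o p j)).
transitivity (\sum_(p : n.+1.-tuple 'I_k) (v p)%:E * exp_series lam (c' p) t)%E.
  apply: eq_bigr => p _; rewrite /v /path_weight; case: ifP => pn; last first.
    by rewrite mul0r mulr0 mul0e.
  rewrite (measure_path c n t0 (fun i => rates (nth o p i))) mul1r -eo.
  by rewrite (inj_eq e_inj).
rewrite exp_series_sum; last 2 first.
- by move=> p; rewrite mulr_ge0.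
- by move=> p m; exact: coef_ge0.
congr (exp_series lam _ t); apply/funext => m.
rewrite (big_tuple_cons n (fun p => (nth o p 0 == o)%:R * path_weight n p *
  jump_coef lam n (fun j => q (nth o p j)) m)).
rewrite (bigD1 o)//= [X in _ + X]big1 ?addr0.
  by apply: eq_bigr => p _; rewrite eqxx mul1r.
by move=> i /negPf io; rewrite big1// => p _; rewrite io !mul0r.
Qed.

(** The events for distinct numbers of jumps are disjoint, and [sum_a] adds their series up to the
    diagonal entry at [o] of exp(tG). *)
Lemma measure_returns_within :
  P (returns_within (range e)) = exp_series lam (fun m => (killed_mx lam ^+ m) o o) t.
Proof.
rewrite measure_bigcup//=; last 2 first.
- by move=> n _; exact: measurable_stays_until.
- apply/trivIsetP => n n' _ _ nn'; apply/seteqP; split => // s [[[h1 h2] _] [[h1' h2'] _]].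
  move: nn'; rewrite neq_ltn => /orP[lt|lt].
    by have := h1' _ lt; rewrite leNgt h2.
  by have := h1 _ lt; rewrite leNgt h2'.
under eq_eseriesr do rewrite measure_stays_until.
rewrite (eq_eseriesl (Q := xpredT)); last by move=> n; apply: mem_set.
by apply: nneseries_exp_series => // m N mN; exact: sum_a.
Qed.

End stay.

(** * Exit rates and killed generators *)

Section environment_facts.
Context (R : realType) (d : nat).
Implicit Types (w : environment R d) (x y z : lattice d).

Lemma finite_nbr x : finite_set [set y | nbr x y].
Proof.
(* The values 0, 1, 2 of [f i] stand for the offsets -1, 0, 1, the only ones possible between
   neighbours. *)
pose g (f : {ffun 'I_d -> 'I_3}) : lattice d := \row_i (x 0 i + (f i : nat)%:Z - 1).
apply: (@sub_finite_set _ _ (range g)); last exact/finite_image/finite_finset.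
move=> y /= /eqP xy.
have bnd i : (`|y 0 i - x 0 i| <= 1)%R.
  rewrite -xy (bigD1 i)//= distrC lerDl; apply: sumr_ge0 => j _; exact: normr_ge0.
have lt3 i : (`|(y 0 i - x 0 i + 1)%R|%N < 3)%N by have := bnd i; lia.
exists [ffun i => Ordinal (lt3 i)] => //.
by apply/rowP => i; rewrite !mxE ffunE/=; have := bnd i; lia.
Qed.

Lemma exit_rateE w x : exit_rate w x = \sum_(y <- fset_set [set y | nbr x y]) w x y.
Proof. by rewrite /exit_rate fsbig_finite//; exact: finite_nbr. Qed.

Lemma mem_fset_nbr x y : (y \in fset_set [set y | nbr x y]) = nbr x y.
Proof.
rewrite in_fset_set; last exact: finite_nbr.
by have [h|/negP h] := boolP (nbr x y); [rewrite mem_set|rewrite memNset].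
Qed.

Lemma conductance_eq0 w x y : ~~ nbr x y -> w x y = 0.
Proof.
move=> xy; apply/eqP; rewrite eq_le conductance_ge0 andbT leNgt.
by apply/negP => /conductance_gt0; exact/negP.
Qed.

(** Only neighbours of [x] contribute on the left, each at most once because [e] is injective. *)
Lemma sum_le_nbr k (e : 'I_k -> lattice d) x (f : lattice d -> R) :
  injective e -> (forall y, 0 <= f y) -> (forall y, ~~ nbr x y -> f y = 0) ->
  \sum_j f (e j) <= \sum_(y <- fset_set [set y | nbr x y]) f y.
Proof.
move=> e_inj f0 fnbr; set r := fset_set _.
pose l := [seq e j | j <- enum 'I_k].
have -> : \sum_j f (e j) = \sum_(y <- l) f y by rewrite big_map big_enum.
have -> : \sum_(y <- l) f y = \sum_(y <- [seq y <- l | y \in r]) f y.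
  rewrite big_filter [RHS]big_mkcond/=; apply: eq_bigr => y _.
  by rewrite /r mem_fset_nbr; case: ifPn => // /fnbr.
have perm : perm_eq [seq y <- l | y \in r] [seq y <- r | y \in l].
  apply: uniq_perm => [||y]; last by rewrite !mem_filter andbC.
    by rewrite filter_uniq// map_inj_uniq// enum_uniq.
  exact/filter_uniq/fset_uniq.
rewrite (perm_big _ perm)/= big_filter [leLHS]big_mkcond/=.
by apply: ler_sum => y _; case: ifP.
Qed.

Lemma exit_rate_gt0 w x : (1 <= d)%N -> 0 < exit_rate w x.
Proof.
move=> d1; pose y : lattice d := x + delta_mx 0 (Ordinal d1).
have xy : nbr x y.
  rewrite /nbr (bigD1 (Ordinal d1))//= big1 => [|i id].
    by rewrite !mxE !eqxx/= addr0 opprD addrA subrr sub0r normrN normr1.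
  by rewrite !mxE eqxx/= (negPf id) addr0 subrr normr0.
apply: (@lt_le_trans _ _ (w x y)); first exact/conductance_gt0.
have := @sum_le_nbr 1 (fun=> y) x (w x); rewrite big_ord1 -exit_rateE; apply.
- by move=> i j _; rewrite [i]ord1 [j]ord1.
- exact: conductance_ge0.
- exact: conductance_eq0.
Qed.

Lemma exit_rate_shift (w : Omega R d) z x : exit_rate (Defs.shift z w) x = exit_rate w (x + z).
Proof.
have nbrD a b : nbr (a + z) (b + z) = nbr a b.
  by rewrite /nbr; under eq_bigr do rewrite !mxE opprD addrACA subrr addr0.
rewrite !exit_rateE.
have perm : perm_eq [seq y + z | y <- fset_set [set y | nbr x y]]
    (fset_set [set y | nbr (x + z) y]).
  apply: uniq_perm => [||y]; rewrite ?fset_uniq ?map_inj_uniq ?fset_uniq//; first exact: addIr.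
  rewrite mem_fset_nbr; apply/mapP/idP => [[y' + ->]|xy].
    by rewrite mem_fset_nbr nbrD.
  by exists (y - z); rewrite ?mem_fset_nbr -?(nbrD _ (y - z)) subrK.
by rewrite -(perm_big _ perm) big_map.
Qed.

Lemma killed_mx_shift k (e : 'I_k -> lattice d) (w : Omega R d) z lam :
  killed_mx (Defs.shift z w) (fun i => e i - z) lam = killed_mx w e lam.
Proof.
apply/matrixP => i j; rewrite !mxE exit_rate_shift subrK.
by rewrite /= !subrK.
Qed.

Section killed.
Context (k : nat) (e : 'I_k -> lattice d) (lam : R).
Hypothesis e_inj : injective e.

Lemma sum_conductance_le w i : \sum_j w (e i) (e j) <= exit_rate w (e i).
Proof.
rewrite exit_rateE; apply: sum_le_nbr => // y; first exact: conductance_ge0.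
exact: conductance_eq0.
Qed.

(** With W_ij = w(e_i, e_j), the form is the sum of (lam - q_i - sum_j W_ij) v_i^2 plus half the sum
    of W_ij (v_i + v_j)^2. The first coefficients are nonnegative since the row sums of W are at
    most q_i and 2 q_i <= lam. *)
Lemma psd_killed_mx w : (forall i, 2 * exit_rate w (e i) <= lam) ->
  psd (killed_mx w e lam).
Proof.
move=> hlam; split.
  apply/matrixP => i j; rewrite !mxE conductance_sym eq_sym.
  by have [->|] := eqVneq i j; rewrite ?mul0r.
move=> v.
have -> : (v^T *m killed_mx w e lam *m v) 0 0 =
   \sum_i \sum_j (v i 0 * ((i == j)%:R * (lam - exit_rate w (e i)) + w (e i) (e j)) * v j 0).
  rewrite exchange_big mxE; apply: eq_bigr => j _.
  by rewrite mxE big_distrl/=; apply: eq_bigr => i _; rewrite !mxE.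
pose W i j := w (e i) (e j).
have -> : \sum_i \sum_j (v i 0 *
    ((i == j)%:R * (lam - exit_rate w (e i)) + w (e i) (e j)) * v j 0) =
  \sum_i (lam - exit_rate w (e i) - \sum_j W i j) * v i 0 ^+ 2 +
  \sum_i \sum_j 2^-1 * (W i j * (v i 0 + v j 0) ^+ 2).
  have -> : \sum_i \sum_j 2^-1 * (W i j * (v i 0 + v j 0) ^+ 2) =
    \sum_i \sum_j W i j * v i 0 ^+ 2 + \sum_i \sum_j v i 0 * W i j * v j 0.
    have half : \sum_i \sum_j W i j * v i 0 ^+ 2 =
      \sum_i \sum_j 2^-1 * (W i j * v i 0 ^+ 2) + \sum_i \sum_j 2^-1 * (W i j * v j 0 ^+ 2).
      have -> : \sum_i \sum_j 2^-1 * (W i j * v j 0 ^+ 2) =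
          \sum_i \sum_j 2^-1 * (W i j * v i 0 ^+ 2).
        rewrite exchange_big/=; apply: eq_bigr => i _; apply: eq_bigr => j _.
        by rewrite /W conductance_sym.
      rewrite -big_split; apply: eq_bigr => i _; rewrite -big_split; apply: eq_bigr => j _ /=.
      by field.
    rewrite half -!big_split; apply: eq_bigr => i _; rewrite -!big_split; apply: eq_bigr => j _ /=.
    by field.
  rewrite addrA -big_split -big_split; apply: eq_bigr => i _ /=.
  rewrite mulrBl mulr_suml subrK.
  under eq_bigr do rewrite mulrDr mulrDl.
  rewrite big_split/=; congr (_ + _).
  rewrite (bigD1 i)//= eqxx mul1r big1 ?addr0; first by ring.
  by move=> j /negPf ji; rewrite eq_sym ji mul0r mulr0 mul0r.
apply: addr_ge0; apply: sumr_ge0 => i _.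
  rewrite mulr_ge0 ?sqr_ge0//.
  have := sum_conductance_le w i; have := hlam i; rewrite -/(W i); lra.
by apply: sumr_ge0 => j _; rewrite mulr_ge0 ?invr_ge0// mulr_ge0 ?sqr_ge0 ?conductance_ge0.
Qed.

(** The segment between the two matrices consists of convex combinations of positive semidefinite
    ones. For the derivative, tr(DE) is the sum of r_i E_ii minus that of V_ij E_ij, where V is
    symmetric and nonnegative with row sums at most r_i; [psd_entries] bounds E_ij by the mean of
    E_ii and E_jj. *)
Lemma mxtrace_killed_le w w' m : (forall x y, w x y <= w' x y) ->
  (forall i, 2 * exit_rate w (e i) <= lam) ->
  (forall i, 2 * exit_rate w' (e i) <= lam) ->
  \tr (killed_mx w' e lam ^+ m) <= \tr (killed_mx w e lam ^+ m).
Proof.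
move=> ww' hlam hlam'.
pose A := killed_mx w' e lam; pose D := killed_mx w e lam - A.
have -> : killed_mx w e lam = A + D by rewrite addrC subrK.
apply: mxtrace_exp_le => [s s0 s1|E pE].
  have -> : A + s *: D = (1 - s) *: A + s *: killed_mx w e lam.
    by rewrite /D scalerBr scalerBl scale1r addrAC addrA addrAC.
  by apply: psd_convex; rewrite ?subr_ge0//; exact: psd_killed_mx.
pose V i j := w' (e i) (e j) - w (e i) (e j).
have V0 i j : 0 <= V i j by rewrite subr_ge0.
pose r i := exit_rate w' (e i) - exit_rate w (e i).
have Vr i : \sum_j V i j <= r i.
  rewrite /r !exit_rateE -sumrB.
  apply: (@sum_le_nbr _ e (e i) (fun y => w' (e i) y - w (e i) y)) => // y.
    by rewrite subr_ge0.
  by move=> xy; rewrite !conductance_eq0// subrr.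
have sE i j : E i j = E j i by rewrite -{1}pE.1 mxE.
have -> : \tr (D *m E) = \sum_i r i * E i i - \sum_i \sum_j V i j * E i j.
  rewrite -sumrB; apply: eq_bigr => i _; rewrite mxE.
  rewrite (eq_bigr (fun j => (i == j)%:R * r i * E i j - V i j * E i j)); last first.
    by move=> j _; rewrite !mxE [E j i]sE /r /V; ring.
  rewrite sumrB (bigD1 i)//= eqxx mul1r [X in _ + X - _]big1 ?addr0//.
  by move=> j /negPf ji; rewrite eq_sym ji !mul0r.
rewrite subr_ge0.
apply: (@le_trans _ _ (\sum_i \sum_j V i j * E i i)); last first.
  apply: ler_sum => i _; rewrite -mulr_suml ler_wpM2r//.
  exact: (psd_entries i i pE).1.
(* By symmetry of [V], E_ii may be replaced by the mean of E_ii and E_jj. *)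
have -> : \sum_i \sum_j V i j * E i i = \sum_i \sum_j V i j * (2^-1 * (E i i + E j j)).
  have half : \sum_i \sum_j V i j * E i i = \sum_i \sum_j V i j * E j j.
    rewrite exchange_big/=; apply: eq_bigr => i _; apply: eq_bigr => j _.
    by rewrite /V !(conductance_sym _ (e j)).
  have -> : \sum_i \sum_j V i j * (2^-1 * (E i i + E j j)) =
    2^-1 * (\sum_i \sum_j V i j * E i i + \sum_i \sum_j V i j * E j j).
    rewrite -big_split mulr_sumr; apply: eq_bigr => i _.
    rewrite -big_split mulr_sumr; apply: eq_bigr => j _ /=; ring.
  by rewrite -half; field.
apply: ler_sum => i _; apply: ler_sum => j _; rewrite ler_wpM2l//.
by have := (psd_entries i j pE).2; lra.
Qed.

End killed.
End environment_facts.

(** * Averaging over a box *)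

Lemma exp_series_le (R : realType) (lam t : R) (a b : nat -> R) :
  (forall m, 0 <= a m) -> (forall m, a m <= b m) ->
  (exp_series lam a t <= exp_series lam b t)%E.
Proof.
move=> a0 ab; rewrite /exp_series; case: ifPn => // t0.
have u0 m : 0 <= expR (- lam * t) * (t ^+ m / m`!%:R).
  by rewrite mulr_ge0 ?expR_ge0// mulr_ge0// ?invr_ge0// exprn_ge0.
apply: lee_nneseries => m _; first by rewrite lee_fin mulr_ge0.
by rewrite lee_fin ler_wpM2l.
Qed.

(** * Measurability in the environment *)

Section measurable_environment.
Context (R : realType) (d : nat).

Lemma measurable_conductance (x y : lattice d) :
  measurable_fun setT (fun w : Omega R d => conductance w x y).
Proof.
move=> _ B mB; rewrite setTI; apply: sub_sigma_algebra.
by exists x, y; exists B.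
Qed.

Lemma measurable_exit_rate (x : lattice d) :
  measurable_fun setT (fun w : Omega R d => exit_rate w x).
Proof.
under eq_fun do rewrite exit_rateE.
by apply: measurable_sum => y; exact: measurable_conductance.
Qed.

Lemma measurable_shift (z : lattice d) :
  measurable_fun setT (Defs.shift z : Omega R d -> Omega R d).
Proof.
have gen := @measurability _ _ (Omega R d) (Omega R d) setT (Defs.shift z) (@cylinders R d) erefl.
apply: gen => _ [_ [x [y [B mB ->]]] <-].
rewrite setTI; apply: sub_sigma_algebra.
by exists (x + z), (y + z), B.
Qed.

Lemma measurable_killed_mx k (e : 'I_k -> lattice d) (lam : Omega R d -> R) m i j :
  measurable_fun setT lam ->
  measurable_fun setT (fun w : Omega R d => (killed_mx w e (lam w) ^+ m) i j).
Proof.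
move=> mlam; elim: m i j => [|m IH] i j.
  by under eq_fun do rewrite expr0 mxE; exact: measurable_cst.
under eq_fun do rewrite exprS -[_ * _]/(_ *m _) mxE.
apply: measurable_sum => l; apply: measurable_funM; last exact: IH.
under eq_fun do rewrite mxE.
apply: measurable_funD; last exact: measurable_conductance.
apply: measurable_funM => //; apply: measurable_funB => //.
exact: measurable_exit_rate.
Qed.

Lemma killed_mxX_ge0 k (e : 'I_k -> lattice d) (lam : R) (w : environment R d) m i j :
  (forall i, exit_rate w (e i) <= lam) -> 0 <= (killed_mx w e lam ^+ m) i j.
Proof.
move=> h; elim: m i j => [|m IH] i j.
  by rewrite expr0 mxE ler0n.
rewrite exprS -[_ * _]/(_ *m _) mxE; apply: sumr_ge0 => l _; apply: mulr_ge0 => //.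
by rewrite mxE addr_ge0 ?conductance_ge0// mulr_ge0// subr_ge0.
Qed.

End measurable_environment.

(** * Return probabilities in a box and their sum *)

Section averaging.
Context (R : realType) (d : nat) (hd : (1 <= d)%N).
Context (X : forall w : Omega R d, chain w 0) (t : R) (t0 : 0 <= t).

Definition return_prob (A : set (lattice d)) (w : Omega R d) : \bar R :=
  chain_prob (X w) (returns_within t (c := X w) A).

(** The box [0, n)^d seen from its point [z], that is, translated by [- z]. *)
Definition box (n : nat) (z : lattice d) : set (lattice d) :=
  [set y | forall j, (0 <= y 0 j + z 0 j < n%:Z)%R].

Notation cells n := {ffun 'I_d -> 'I_n}.

Definition corner n (f : cells n) : lattice d := \row_j (f j : nat)%:Z.

(** Enumerates [0, n)^d by an ordinal, as [killed_mx] requires. *)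
Definition cell n (i : 'I_#|cells n|) : lattice d := corner (enum_val i).

Lemma corner_inj n : injective (@corner n).
Proof.
move=> f g /rowP fg; apply/ffunP => j; apply: val_inj.
by have := fg j; rewrite !mxE => -[].
Qed.

Lemma cell_inj n : injective (@cell n).
Proof. by move=> i j /corner_inj/enum_val_inj. Qed.

Lemma range_cell n z : range (fun i => @cell n i - z) = box n z.
Proof.
apply/seteqP; split => [_ [i _ <-] j|y yz].
  have -> : (cell i - z) 0 j + z 0 j = (enum_val i j : nat)%:Z by rewrite !mxE subrK.
  by have := ltn_ord (enum_val i j); rewrite ltz_nat => ->.
have yz' j : 0 <= y 0 j + z 0 j < n%:Z := yz j.
have lt j : (`|(y 0 j + z 0 j)%R|%N < n)%N.
  by have /andP[u0 un] := yz' j; rewrite -ltz_nat gez0_abs.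
exists (enum_rank [ffun j => Ordinal (lt j)]) => //.
apply/rowP => j; rewrite !mxE enum_rankK ffunE/=.
by have /andP[u0 un] := yz' j; rewrite gez0_abs// addrK.
Qed.

(** A uniformization rate valid for the whole range of [e] and measurable in [w]. *)
Definition max_rate k (e : 'I_k -> lattice d) (w : Omega R d) : R :=
  1 + 2 * \sum_i exit_rate w (e i).

Lemma max_rate_bound k (e : 'I_k -> lattice d) w i :
  0 < exit_rate w (e i) /\ exit_rate w (e i) < max_rate e w /\
  2 * exit_rate w (e i) <= max_rate e w.
Proof.
have q0 j : 0 < exit_rate w (e j) by exact: exit_rate_gt0.
have := q0 i; rewrite /max_rate (bigD1 i)//=.
have : 0 <= \sum_(j < k | j != i) exit_rate w (e j) by apply: sumr_ge0 => j _; exact: ltW.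
by set s := \sum_(j < k | _) _; set q := exit_rate _ _; lra.
Qed.

(** The translation carries the chain from 0 in the shifted environment to the chain from [cell o]
    in [w], so every [o] yields a diagonal entry of one and the same matrix. *)
Lemma return_prob_cell n o (w : Omega R d) lam :
  (forall i, 0 < exit_rate w (@cell n i) < lam) ->
  return_prob (box n (@cell n o)) (Defs.shift (cell o) w) =
  exp_series lam (fun m => (killed_mx w (@cell n) lam ^+ m) o o) t.
Proof.
move=> hlam; rewrite /return_prob -range_cell.
rewrite (@measure_returns_within _ _ _ _ _ (fun i => cell i - cell o) o lam t t0).
- by congr exp_series; apply/funext => m; rewrite killed_mx_shift.
- by move=> i; rewrite exit_rate_shift subrK.
- by move=> i j /addIr/cell_inj.
- by rewrite subrr.
Qed.

(** The realizations [X w] depend on [w] in an arbitrary way; measurability comes from the explicit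
    series in the conductances. *)
Lemma measurable_return_prob n o :
  measurable_fun setT (return_prob (box n (@cell n o))).
Proof.
pose e i : lattice d := @cell n i - cell o.
have -> : return_prob (box n (@cell n o)) =
    fun w => (\sum_(m <oo | true) (expR (- max_rate e w * t) * (t ^+ m / m`!%:R) *
      (killed_mx w e (max_rate e w) ^+ m) o o)%:E)%E.
  apply/funext => w; rewrite /return_prob -range_cell -/e.
  rewrite (@measure_returns_within _ _ _ _ _ e o (max_rate e w) t t0).
  - by rewrite /exp_series t0.
  - by move=> i; have [-> [->]] := max_rate_bound e w i.
  - by move=> i j /addIr/cell_inj.
  - by rewrite /e subrr.
have mlam : measurable_fun setT (max_rate e).
  apply: measurable_funD => //; apply: measurable_funM => //.
  by apply: measurable_sum => i; exact: measurable_exit_rate.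
apply: ge0_emeasurable_sum => [m w _ _|m _].
  rewrite lee_fin mulr_ge0//.
    by rewrite mulr_ge0 ?expR_ge0// mulr_ge0// ?invr_ge0// exprn_ge0.
  by apply: killed_mxX_ge0 => i; have [_ [/ltW]] := max_rate_bound e w i.
apply/measurable_EFinP; apply: measurable_funM; last exact: measurable_killed_mx.
apply: measurable_funM => //; apply: measurableT_comp => //.
by apply: measurable_funM => //; exact: measurableT_comp.
Qed.

Lemma return_prob_ge0 A w : (0 <= return_prob A w)%E.
Proof. exact: measure_ge0. Qed.

(** This is the trace of exp(tG) for the chain killed outside [0, n)^d, written so that each term is
    a return probability at 0 in a shifted environment. *)
Definition total_return n (w : Omega R d) : \bar R :=
  (\sum_(o < #|cells n|) return_prob (box n (cell o)) (Defs.shift (cell o) w))%E.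

Lemma total_returnE n (w : Omega R d) lam :
  (forall i, 0 < exit_rate w (@cell n i) < lam) ->
  total_return n w = exp_series lam (fun m => \tr (killed_mx w (@cell n) lam ^+ m)) t.
Proof.
move=> hlam; rewrite /total_return.
under eq_bigr do rewrite (return_prob_cell _ hlam) -[exp_series _ _ _]mul1e.
rewrite (@exp_series_sum _ _ lam t (fun=> 1) (fun o m => (killed_mx w (@cell n) lam ^+ m) o o))//.
  by congr exp_series; apply/funext => m; apply: eq_bigr => i _; rewrite mul1r.
by move=> i m; apply: killed_mxX_ge0 => j; have /andP[_ /ltW] := hlam j.
Qed.

Lemma total_return_antimonotone n (w w' : Omega R d) :
  (forall x y, conductance w x y <= conductance w' x y) ->
  (total_return n w' <= total_return n w)%E.
Proof.
(* The traces are compared with one uniformization rate, large enough for both environments. *)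
move=> ww'; pose lam := max_rate (@cell n) w + max_rate (@cell n) w'.
have pos v : 0 <= max_rate (@cell n) v.
  rewrite /max_rate addr_ge0// mulr_ge0// sumr_ge0// => i _.
  by apply/ltW; exact: exit_rate_gt0.
have p := pos w; have p' := pos w'.
rewrite (@total_returnE n w lam); last first.
  by move=> i; have := max_rate_bound (@cell n) w i; rewrite /lam; lra.
rewrite (@total_returnE n w' lam); last first.
  by move=> i; have := max_rate_bound (@cell n) w' i; rewrite /lam; lra.
apply: exp_series_le => m.
  apply: sumr_ge0 => i _; apply: killed_mxX_ge0 => j.
  by have := max_rate_bound (@cell n) w' j; rewrite /lam; lra.
apply: mxtrace_killed_le => //; first exact: cell_inj.
  by move=> i; have := max_rate_bound (@cell n) w i; rewrite /lam; lra.
by move=> i; have := max_rate_bound (@cell n) w' i; rewrite /lam; lra.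
Qed.

End averaging.

(** * Comparison under the two laws of the environment *)

Section comparison.
Context (R : realType) (d : nat) (hd : (1 <= d)%N).
Context (X : forall w : Omega R d, chain w 0) (t : R) (t0 : 0 <= t).
Notation ret := (return_prob X t).
Notation cells n := {ffun 'I_d -> 'I_n}.

(** The least index chosen by [position] is the number of jumps fixed by [jumps_at]. *)
Lemma position_returnsE w : [set s : chain_space (X w) | position t s = Some 0] =
  returns_within t (c := X w) setT.
Proof.
apply/seteqP; split => s /=; rewrite /position.
  case: pselect => // e'; case: ex_minnP => n tn nmin [sn].
  exists n => //; split; last by split.
  by split => // i ilt; rewrite leNgt; apply/negP => /nmin; rewrite leqNgt ilt.
move=> [n _ [[hn tn] [_ sn]]]; case: pselect => [e'|]; last by case; exists n.
case: ex_minnP => m tm mmin.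
suff -> : m = n by rewrite sn.
apply/eqP; rewrite eqn_leq mmin//= leqNgt; apply/negP => mn.
by have := hn _ mn; rewrite leNgt tm.
Qed.

Lemma returns_within_subset w (A B : set (lattice d)) : A `<=` B ->
  returns_within t (c := X w) A `<=` returns_within t (c := X w) B.
Proof.
by move=> AB s [n _ [Js [As sn]]]; exists n => //; split=> //; split=> // i /As /AB.
Qed.

Lemma measurable_returns_cell w n o :
  measurable (returns_within t (c := X w) (box n (@cell d n o))).
Proof.
rewrite -range_cell; apply: bigcup_measurable => m _.
by apply: measurable_stays_until; [move=> i j /addIr/cell_inj|exact: subrr].
Qed.

(** This is [-M, M]^d, as a box of side 2M + 1 seen from its centre, so that the results on boxes
    apply to it. *)
Definition cube (M : nat) : set (lattice d) := box M.*2.+1 (const_mx M%:Z).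

Lemma cubeP M y : cube M y <-> forall j, (`|y 0 j| <= M%:Z)%R.
Proof.
split=> h j.
  have : (0 <= y 0 j + (const_mx M%:Z : lattice d) 0 j < M.*2.+1%:Z)%R := h j.
  by rewrite mxE; lia.
by have := h j; rewrite mxE; lia.
Qed.

Lemma cube_center M : exists o, const_mx M%:Z = @cell d M.*2.+1 o.
Proof.
exists (enum_rank [ffun=> inord M]); apply/rowP => j.
by rewrite !mxE enum_rankK ffunE inordK// ltnS -addnn leq_addr.
Qed.

Lemma measurable_returns_cube w M : measurable (returns_within t (c := X w) (cube M)).
Proof. by rewrite /cube; have [i ->] := cube_center M; exact: measurable_returns_cell. Qed.

Lemma returns_setT w : returns_within t (c := X w) setT =
  \bigcup_M returns_within t (c := X w) (cube M).
Proof.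
apply/seteqP; split => [s [n _ [Js [_ sn]]]|s [M _]]; last exact: returns_within_subset.
(* Finitely many sites are visited before t; the sum of all their absolute coordinates bounds each
   of them. *)
exists (\sum_(i < n.+1) \sum_j `|site i s ord0 j|)%N => //.
exists n => //; split=> //; split=> // i ilt; apply/cubeP => j.
rewrite -abszE lez_nat (bigD1 (Ordinal ilt))//= (bigD1 j)//=.
by rewrite -addnA leq_addr.
Qed.

Lemma cvg_return_cube w : ret (cube M) w @[M --> \oo] --> transition_prob (X w) t 0.
Proof.
rewrite /transition_prob position_returnsE returns_setT.
apply: nondecreasing_cvg_mu.
- by move=> M; exact: measurable_returns_cube.
- by apply: bigcup_measurable => M _; exact: measurable_returns_cube.
- move=> M M' MM'; apply/subsetPset/returns_within_subset => y /cubeP yM; apply/cubeP => j.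
  by apply: le_trans (yM j) _; rewrite lez_nat.
Qed.

Lemma return_cube_nd w : {homo (fun M => ret (cube M) w) : M M' / (M <= M')%N >-> (M <= M')%E}.
Proof.
move=> M M' MM'; apply: (le_measure (chain_prob (X w)));
  do ?[exact/mem_set/measurable_returns_cube].
apply: returns_within_subset => y /cubeP yM; apply/cubeP => j.
by apply: le_trans (yM j) _; rewrite lez_nat.
Qed.

Lemma measurable_return_cube M : measurable_fun setT (ret (cube M)).
Proof. by rewrite /cube; have [i ->] := cube_center M; exact: measurable_return_prob. Qed.

Lemma measurable_transition_prob :
  measurable_fun setT (fun w => transition_prob (X w) t 0).
Proof.
apply: (emeasurable_fun_cvg (fun M => ret (cube M))) => [M|w _].
  exact: measurable_return_cube.
exact: cvg_return_cube.
Qed.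

Lemma return_prob_le_transition w n o :
  (ret (box n (@cell d n o)) w <= transition_prob (X w) t 0)%E.
Proof.
rewrite /transition_prob position_returnsE.
apply: (le_measure (chain_prob (X w))); first exact/mem_set/measurable_returns_cell.
  apply: mem_set; rewrite returns_setT.
  by apply: bigcup_measurable => M _; exact: measurable_returns_cube.
exact: returns_within_subset.
Qed.

Lemma integral_shift (Q : probability (Omega R d) R) (z : lattice d)
    (f : Omega R d -> \bar R) : translation_invariant Q ->
  measurable_fun setT f -> (forall w, 0 <= f w)%E ->
  (\int[Q]_w f (Defs.shift z w) = \int[Q]_w f w)%E.
Proof.
move=> Qinv mf f0.
have mz := @measurable_shift R d z.
pose Qz : {measure set (Omega R d) -> \bar R} :=
  measure_function_pushforward__canonical__measure_function_Measure Q mz.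
transitivity (\int[Qz]_w f w)%E.
  by rewrite [RHS]ge0_integral_pushforward.
by apply: eq_measure_integral => A mA _; exact: Qinv.
Qed.

(** Translation invariance removes the shift from each term. *)
Lemma integral_total_return (Q : probability (Omega R d) R) n :
  translation_invariant Q ->
  (\int[Q]_w total_return X t n w =
   \sum_(o < #|cells n|) \int[Q]_w ret (box n (cell o)) w)%E.
Proof.
move=> Qinv; rewrite /total_return ge0_integral_sum//.
- apply: eq_bigr => o _; apply: (integral_shift (cell o) Qinv).
    exact: measurable_return_prob.
  by move=> w; exact: return_prob_ge0.
- move=> o; have mr := @measurable_return_prob R d hd X t t0 n o.
  exact: (measurableT_comp mr (@measurable_shift R d (cell o))).
Qed.

Context (Q Q' : probability (Omega R d) R).
Hypotheses (Qinv : translation_invariant Q) (Q'inv : translation_invariant Q').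
Hypothesis QQ' : stochastically_dominates Q' Q.

(** Stochastic domination is applied to minus [total_return], which is increasing, measurable and
    bounded by the number of cells. *)
Lemma le_sum_integral_return n :
  (\sum_(o < #|cells n|) \int[Q']_w ret (box n (cell o)) w <=
   \sum_(o < #|cells n|) \int[Q]_w ret (box n (cell o)) w)%E.
Proof.
rewrite -!integral_total_return//.
have mt : measurable_fun setT (total_return X t n).
  apply: emeasurable_sum => o; have mr := @measurable_return_prob R d hd X t t0 n o.
  exact: (measurableT_comp mr (@measurable_shift R d (cell o))).
have tot0 w : (0 <= total_return X t n w)%E.
  by apply: sume_ge0 => o _; exact: return_prob_ge0.
have totk w : (total_return X t n w <= (#|cells n|%:R)%:E)%E.
  rewrite /total_return; apply: (@le_trans _ _ (\sum_(o < #|cells n|) 1)%E).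
    by apply: lee_sum => o _; apply: probability_le1; exact: measurable_returns_cell.
  by rewrite sumEFin sumr_const card_ord.
have fin w : total_return X t n w \is a fin_num.
  by rewrite ge0_fin_numE// (le_lt_trans (totk w))// ltry.
pose f w := - fine (total_return X t n w).
have fE w : (f w)%:E = (- total_return X t n w)%E by rewrite /f EFinN fineK.
have := QQ' (f := f); rewrite (eq_integral _ _ (fun w _ => fE w)).
rewrite [X in (_ -> _ -> _ -> _ <= X)%E](eq_integral _ _ (fun w _ => fE w)).
rewrite !integral_ge0N// leeN2; apply.
- by apply/measurable_EFinP; rewrite (_ : EFin \o f = fun w => (- total_return X t n w)%E);
    [exact: measurableT_comp|apply/funext => w; exact: fE].
- exists #|cells n|%:R => w; rewrite /f normrN ger0_norm ?fine_ge0//.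
  by rewrite -lee_fin fineK.
- move=> w w' ww'; rewrite -lee_fin !fE leeN2.
  exact: total_return_antimonotone.
Qed.

(** In a box of side K + 2M, the K^d points at distance at least M from the boundary see a box that
    contains the cube. Hence K^d a <= (K + 2M)^d b, and dividing by K^d and letting K grow gives the
    claim. *)
Lemma le_integral_return_cube M :
  (\int[Q']_w ret (cube M) w <= \int[Q]_w transition_prob (X w) t 0)%E.
Proof.
set a := (\int[Q']_w _)%E; set b := (\int[Q]_w _)%E.
have ge0 (P : probability (Omega R d) R) A : (0 <= \int[P]_w ret A w)%E.
  by apply: integral_ge0 => w _; exact: return_prob_ge0.
have le1 (P : probability (Omega R d) R) (f : Omega R d -> \bar R) :
    measurable_fun setT f -> (forall w, 0 <= f w <= 1)%E -> (\int[P]_w f w <= 1)%E.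
  move=> mf f01; apply: (@le_trans _ _ (\int[P]_w cst 1 w)%E).
    by apply: ge0_le_integral => // w _; have /andP[] := f01 w.
  by rewrite integral_cst// mul1e; exact: probability_le1.
have b0 : (0 <= b)%E by apply: integral_ge0 => w _; exact: measure_ge0.
have afin : a \is a fin_num.
  rewrite ge0_fin_numE ?ge0// (@le_lt_trans _ _ 1%E) ?ltry// le1//.
    exact: measurable_return_cube.
  move=> w; rewrite return_prob_ge0/=; apply: probability_le1.
  exact: measurable_returns_cube.
have bfin : b \is a fin_num.
  rewrite ge0_fin_numE// (@le_lt_trans _ _ 1%E) ?ltry// le1//.
    exact: measurable_transition_prob.
  move=> w; rewrite measure_ge0/=; apply: probability_le1.
  rewrite position_returnsE returns_setT; apply: bigcup_measurable => M' _.
  exact: measurable_returns_cube.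
have key K : ((K ^ d)%:R * fine a <= ((K + M.*2) ^ d)%:R * fine b)%R.
  rewrite -lee_fin !EFinM !fineK//.
  pose n := (K + M.*2)%N.
  have card_cells m : #|cells m| = (m ^ d)%N by rewrite card_ffun !card_ord.
  apply: (@le_trans _ _ (\sum_(o < #|cells n|) \int[Q']_w ret (box n (cell o)) w)%E); last first.
    apply: le_trans (le_sum_integral_return n) _.
    apply: (@le_trans _ _ (\sum_(o < #|cells n|) b)%E).
      apply: lee_sum => o _; apply: ge0_le_integral => //.
      - exact: measurable_return_prob.
      - exact: measurable_transition_prob.
      - by move=> w _; exact: return_prob_le_transition.
    rewrite (eq_bigr (fun=> (fine b)%:E)); last by move=> o _; rewrite fineK.
    by rewrite sumEFin sumr_const card_ord card_cells -[fine b *+ _]mulr_natl EFinM fineK.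
  have lt (f : cells K) j : (f j + M < n)%N.
    by rewrite /n -addnn addnA (leq_trans (_ : _ < K + M)%N) ?ltn_add2r ?leq_addr.
  (* Adding M to each coordinate places the K^d cells in the interior of the larger box. *)
  pose h (f : cells K) : 'I_#|cells n| := enum_rank [ffun j => Ordinal (lt f j)].
  have h_inj : injective h.
    move=> f g /enum_rank_inj/ffunP fg; apply/ffunP => j; apply: val_inj.
    by have := fg j; rewrite !ffunE => -[] /addIn.
  (* The cells near the boundary contribute nonnegative terms, which are dropped. *)
  rewrite (bigID (mem (h @: [set: cells K]%SET)))/=.
  apply: (@le_trans _ _ (\sum_(o in h @: [set: cells K]%SET)
      \int[Q']_w ret (box n (cell o)) w)%E); last first.
    by rewrite leeDl// sume_ge0.
  rewrite big_imset/=; last by move=> f g _ _ /h_inj.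
  apply: (@le_trans _ _ (\sum_(f in [set: cells K]%SET) a)%E).
    rewrite (eq_bigr (fun=> (fine a)%:E)); last by move=> f _; rewrite fineK.
    by rewrite sumEFin sumr_const cardsT card_cells -[fine a *+ _]mulr_natl EFinM fineK.
  apply: lee_sum => f _; apply: ge0_le_integral => //.
  - exact: measurable_return_cube.
  - exact: measurable_return_prob.
  move=> w _; apply: (le_measure (chain_prob (X w))).
  + exact/mem_set/measurable_returns_cube.
  + exact/mem_set/measurable_returns_cell.
  apply: returns_within_subset => y /cubeP yM j.
  have -> : cell (h f) 0 j = (f j + M)%N%:Z by rewrite !mxE enum_rankK ffunE.
  by have := yM j; have := ltn_ord (f j); rewrite /n; lia.
rewrite -(fineK afin) -(fineK bfin) lee_fin.
(* The bound [key] is used at K + 1, where the ratio of the sides is 1 + 2M / (K + 1) and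
   [harmonic K] is 1 / (K + 1). *)
have lim : ((1 + (M.*2)%:R * harmonic K) ^+ d * fine b @[K --> \oo] --> (fine b : R))%R.
  have lim1 : (1 + (M.*2)%:R * harmonic K @[K --> \oo] --> (1 : R))%R.
    rewrite -[X in _ --> X](addr0 (1 : R)) -(mulr0 ((M.*2)%:R : R)).
    by apply: cvgD; [exact: cvg_cst|apply: cvgMr; exact: cvg_harmonic].
  have lim2 : ((1 + (M.*2)%:R * harmonic K) ^+ d @[K --> \oo] --> (1 : R))%R.
    have lim := continuous_cvg _ (@exprn_continuous R d 1) lim1.
    by rewrite -[X in _ --> X](expr1n _ d); exact: lim.
  have lim3 : (fine b @[K --> \oo] --> fine b)%R by exact: cvg_cst.
  by have lim := cvgM lim2 lim3; rewrite -[X in _ --> X]mul1r; exact: lim.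
apply: (@cvgr_to_ge _ _ _ _ _ _ _ lim); apply: nearW => K.
have K0 : 0 < (K.+1 ^ d)%:R :> R by rewrite ltr0n expn_gt0.
rewrite -(ler_pM2l K0) mulrA.
have -> : (K.+1 ^ d)%:R * (1 + (M.*2)%:R * harmonic K) ^+ d = ((K.+1 + M.*2) ^ d)%:R :> R.
  rewrite !natrX -exprMn mulrDr mulr1 /harmonic/= mulrCA divff ?mulr1 ?natrD//.
exact: key.
Qed.

(** Monotone convergence in M on the left; the bound on the right does not depend on M. *)
Lemma le_integral_transition :
  (\int[Q']_w transition_prob (X w) t 0 <= \int[Q]_w transition_prob (X w) t 0)%E.
Proof.
have cvg : (\int[Q']_w ret (cube M) w @[M --> \oo] --> \int[Q']_w transition_prob (X w) t 0)%E.
  rewrite (eq_integral (fun w => limn (fun M => ret (cube M) w))); last first.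
    by move=> w _; apply/esym/cvg_lim => //; exact: cvg_return_cube.
  apply: cvg_monotone_convergence => //.
  - by move=> M; exact: measurable_return_cube.
  - by move=> w _; exact: return_cube_nd.
by apply: cvge_le cvg; apply: nearW => M; exact: le_integral_return_cube.
Qed.

End comparison.

Theorem lemma2p2 (R : realType) (d : nat) (hd : (1 <= d)%N)
  (Q Q' : probability (Omega R d) R)
  (Qinv : translation_invariant Q)
  (Q'inv : translation_invariant Q')
  (QQ' : stochastically_dominates Q' Q)
  (X : forall w : Omega R d, chain w 0)
  (Xcons : {ae measure_add Q Q', forall w, conservative (X w)}) :
  forall t : R, 0 <= t ->
    (\int[Q']_w transition_prob (X w) t 0 <=
     \int[Q]_w transition_prob (X w) t 0)%E.
Proof. by move=> t t0; exact: le_integral_transition. Qed.
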